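(* Let $\mathbf{u}_h(\cdot,t)\in\mathcal{U}_h^N$ be a solution of the semi-discrete CG-DG scheme: for every element $T_k\in\mathcal{T}_h$ and all test functions $\phi_i\in\mathcal{U}_h^N$, $$\int_{T_k}\phi_i\,\partial_t\mathbf{u}_h\,d\mathbf{x}+\int_{T_k}\phi_i\,\nabla\cdot\tilde{\mathbf{f}}_h\,d\mathbf{x}=0,$$ where $\tilde{\mathbf{f}}_h(\cdot,t)\in\mathcal{W}_h^{N+1}$ is the (globally continuous) discrete flux field. Then for any volume $V\subset\Omega$ (arbitrary, not necessarily related to the mesh) one has the conservation relation $$\frac{d}{dt}\int_V\mathbf{u}_h\,d\mathbf{x}+\int_{\partial V}\tilde{\mathbf{f}}_h\cdot\mathbf{n}\,d\gamma=0,$$ where $\mathbf{n}$ is the outward unit normal to $\partial V$.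
   Context: $\Omega\subset\mathbb{R}^d$ is a bounded computational domain partitioned by a conforming mesh $\mathcal{T}_h=\bigcup T_k$ of non-overlapping simplices. One considers a hyperbolic system of conservation laws $\partial_t\mathbf{q}+\nabla\cdot\mathbf{f}(\mathbf{q})=0$ with state vector $\mathbf{q}(\mathbf{x},t)$ and flux tensor $\mathbf{f}(\mathbf{q})$. For an integer $N\ge 0$, $\mathcal{U}_h^N$ is the space of discontinuous piecewise polynomials of degree at most $N$ on $\mathcal{T}_h$, and $\mathcal{W}_h^{N+1}$ is the classical Lagrange finite element space of globally continuous piecewise polynomials of degree at most $N+1$ on $\mathcal{T}_h$; the same symbols are used for scalar-, vector- and tensor-valued fields (componentwise). The discrete flux field is built from $\mathbf{u}_h$ as follows: $\tilde{\mathbf{w}}_h=\mathbf{\Pi}_h\mathbf{u}_h\in\mathcal{W}_h^{N+1}$ for a projector $\mathbf{\Pi}_h$ (e.g. the $L^2$ projection) from $\mathcal{U}_h^N$ into $\mathcal{W}_h^{N+1}$, and $\tilde{\mathbf{f}}_h\in\mathcal{W}_h^{N+1}$ is the nodal (Lagrange) interpolant of $\mathbf{f}(\tilde{\mathbf{w}}_h)$. The divergence of the flux tensor is taken row by row, so $\nabla\cdot\tilde{\mathbf{f}}_h$ has as many components as $\mathbf{u}_h$. A ''volume'' $V$ means a subset regular enough for the boundary integral, the outward normal and the divergence theorem to make sense (e.g. a Lipschitz domain). *)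

(* Defs.v *)
From HB Require Import structures.
From mathcomp Require Import all_boot all_order all_algebra.
From mathcomp Require Import all_classical all_reals all_analysis.
From mathcomp Require Import measurable_realfun.
From mathcomp Require mpoly.
Import (canonicals, coercions) mpoly.

Set Implicit Arguments.
Unset Strict Implicit.
Unset Printing Implicit Defensive.

Import Order.TTheory GRing.Theory Num.Theory.
Import numFieldNormedType.Exports.

Local Open Scope classical_set_scope.
Local Open Scope ring_scope.

(* The norm of the library on ['rV[R]_n] is the sup norm; it is used for the
   topology and for differentiability only.  Diameters, balls and unit vectors
   refer to the Euclidean structure below. *)
Definition dotv (R : realType) (n : nat) (x y : 'rV[R]_n) : R :=
  \sum_(i < n) x ord0 i * y ord0 i.

Definition enorm (R : realType) (n : nat) (x : 'rV[R]_n) : R :=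
  Num.sqrt (dotv x x).

Definition eball (R : realType) (n : nat) (x : 'rV[R]_n) (r : R) :
  set 'rV[R]_n := [set y | enorm (y - x) <= r].

Definition boundary (T : topologicalType) (A : set T) : set T :=
  closure A `\` interior A.

Definition borelRn (R : realType) (n : nat) :=
  g_sigma_algebraType (@open 'rV[R]_n).

Section borelRn.
Context {R : realType}.

Lemma measurable_fun_coordP d (T : measurableType d) n (f : T -> borelRn R n) :
  measurable_fun setT f <->
  forall i, measurable_fun setT (fun t => (f t : 'rV[R]_n) ord0 i).
Proof.
split=> [mf i|mf].
  apply: (measurability _ (RGenOpens.measurableE R)).
  move=> _ [_ [a [b ->]] <-]; rewrite setTI.
  have -> : (fun t => (f t : 'rV[R]_n) ord0 i) @^-1` `]a, b[ =
      f @^-1` [set x : 'rV[R]_n | `]a, b[%classic (x ord0 i)] by [].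
  rewrite -[X in measurable X]setTI; apply: mf => //.
  apply: sub_sigma_algebra.
  by apply: open_comp => [x _|]; [exact: coord_continuous|exact: interval_open].
apply: (@measurability _ _ T (borelRn R n) setT f (@open 'rV[R]_n) erefl).
move=> _ [U oU <-]; rewrite setTI.
pose box (q : 'rV[rat]_n * rat) : set 'rV[R]_n :=
  [set x | forall i, `|x ord0 i - ratr (q.1 ord0 i)| < ratr q.2].
have -> : f @^-1` U = \bigcup_q (if `[< box q `<=` U >]
    then f @^-1` (box q) else set0).
  apply/seteqP; split=> t /=; last first.
    by move=> [q _]; case: ifPn => // /asboolP; exact.
  move=> Uft; have /nbhs_ballP[e /= e0 eU] := open_nbhs_nbhs (conj oU Uft).
  have /rat_in_itvoo[r /[!in_itv]/= /andP[r0 re]] : 0 < e / 2 by rewrite divr_gt0.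
  have H i : {q | `|(f t : 'rV[R]_n) ord0 i - ratr q| < ratr r}.
    apply: cid.
    have /rat_in_itvoo[q] : (f t : 'rV[R]_n) ord0 i - ratr r <
       (f t : 'rV[R]_n) ord0 i + ratr r by rewrite ltrBlDr -addrA ltrDl addr_gt0.
    rewrite in_itv/= => /andP[q1 q2]; exists q.
    by rewrite distrC ltr_distl q1 q2.
  exists (\row_i sval (H i), r) => //.
  have bft : box (\row_i sval (H i), r) (f t).
    by move=> i /=; rewrite mxE; exact: (svalP (H i)).
  rewrite ifT//; apply/asboolP => x bx; apply: eU; split => // i j.
  rewrite (ord1 i) /ball/= /ball_.
  have := bft j; have /= := bx j; rewrite /= mxE => h1 h2.
  rewrite (le_lt_trans (ler_distD (ratr (sval (H j))) _ _))//.
  rewrite [X in _ < X](splitr e) ltrD// ?(lt_trans h2)//.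
  by rewrite distrC (lt_trans h1).
apply: countable_bigcupT_measurable => // q; case: ifPn => // _.
have -> : f @^-1` box q = \bigcap_(i in [set: 'I_n])
   [set t | `|(f t : 'rV[R]_n) ord0 i - ratr (q.1 ord0 i)| < ratr q.2].
  by apply/seteqP; split=> t /= h i; [move=> _|]; exact: h.
apply: fin_bigcap_measurable => // i _.
have -> : [set t | `|(f t : 'rV[R]_n) ord0 i - ratr (q.1 ord0 i)| < ratr q.2] =
   (fun t => (f t : 'rV[R]_n) ord0 i) @^-1`
     `](ratr (q.1 ord0 i) - ratr q.2), (ratr (q.1 ord0 i) + ratr q.2)[.
  by apply/seteqP; split => t /=; rewrite in_itv/= ltr_distl.
by rewrite -[X in measurable X]setTI; exact: mf.
Qed.

Definition rcons0 n (p : measurableTypeR R * borelRn R n) : borelRn R n.+1 :=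
  row_mx (\row_(_ < 1) (p.1 : R)) (p.2 : 'rV[R]_n).

Definition runcons0 n (x : borelRn R n.+1) : measurableTypeR R * borelRn R n :=
  (lsubmx (x : 'rV[R]_(1 + n)) ord0 ord0, rsubmx (x : 'rV[R]_(1 + n))).

Lemma rcons0K n : cancel (@rcons0 n) (@runcons0 n).
Proof. by move=> [x y]; rewrite /runcons0 row_mxKl row_mxKr mxE. Qed.

Lemma runcons0K n : cancel (@runcons0 n) (@rcons0 n).
Proof.
move=> x; rewrite /rcons0/=.
have -> : \row_(_ < 1) lsubmx (x : 'rV[R]_(1 + n)) ord0 ord0 =
    lsubmx (x : 'rV[R]_(1 + n)) by apply/rowP => i; rewrite (ord1 i) mxE.
exact: (@hsubmxK R 1 1 n x).
Qed.

Lemma measurable_rcons0 n : measurable_fun setT (@rcons0 n).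
Proof.
apply/measurable_fun_coordP => i; rewrite /rcons0.
under eq_fun do rewrite (mxE _ _ _ i).
case: splitP => j _.
  by under eq_fun do rewrite mxE; exact: measurable_fst.
have := (@measurable_fun_coordP _ (borelRn R n) n id).1 (@measurable_id _ _ _) j.
by move=> /measurableT_comp; apply; exact: measurable_snd.
Qed.

Lemma measurable_runcons0 n : measurable_fun setT (@runcons0 n).
Proof.
have mc := (@measurable_fun_coordP _ (borelRn R n.+1) n.+1 id).1
  (@measurable_id _ _ _).
apply/measurable_fun_pairP; split=> /=.
  rewrite (_ : _ \o _ = fun x : borelRn R n.+1 => (x : 'rV[R]_n.+1) ord0 ord0).
    exact: mc.
  by apply/funext => x; rewrite /= !mxE; congr (x _ _); exact/val_inj.
apply/measurable_fun_coordP => i /=.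
rewrite (_ : (fun _ => _) =
  fun x : borelRn R n.+1 => (x : 'rV[R]_n.+1) ord0 (rshift 1 i)); first exact: mc.
by apply/funext => x; rewrite /= !mxE.
Qed.

Section lebesgueS.
Context (n : nat) (mu : {sigma_finite_measure set (borelRn R n) -> \bar R}).

Definition lebesgueS : set (borelRn R n.+1) -> \bar R :=
  pushforward (@lebesgue_measure R \x mu)%E (@rcons0 n).

Let lebesgueS0 : lebesgueS set0 = 0%E.
Proof. by rewrite /lebesgueS /pushforward preimage_set0 measure0. Qed.

Let lebesgueS_ge0 A : (0 <= lebesgueS A)%E.
Proof. by rewrite /lebesgueS /pushforward measure_ge0. Qed.

Let lebesgueS_sigma_additive : semi_sigma_additive lebesgueS.
Proof.
have mF (A : set (borelRn R n.+1)) : measurable A ->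
    measurable (@rcons0 n @^-1` A).
  by move=> mA; rewrite -[X in measurable X]setTI; exact: measurable_rcons0.
move=> F mF' tF mUF; rewrite /lebesgueS /pushforward preimage_bigcup.
apply: measure_semi_sigma_additive => [k||]; first exact: mF.
  apply/trivIsetP => /= i j _ _ ij; rewrite -preimage_setI.
  by move/trivIsetP : tF => /(_ _ _ _ _ ij) ->//; rewrite preimage_set0.
by rewrite -preimage_bigcup; exact: mF.
Qed.

HB.instance Definition _ := isMeasure.Build _ _ _ lebesgueS
  lebesgueS0 lebesgueS_ge0 lebesgueS_sigma_additive.

Let lebesgueS_sigma_finite : sigma_finite setT lebesgueS.
Proof.
pose leb : {sigma_finite_measure set (measurableTypeR R) -> \bar R} :=
  @lebesgue_measure R.
have /sigma_finiteP[F [TF ndF Foo]] := sigma_finiteT leb.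
have /sigma_finiteP[G [TG ndG Goo]] := sigma_finiteT mu.
exists (fun k => @runcons0 n @^-1` (F k `*` G k)).
  rewrite -preimage_bigcup (_ : \bigcup_k _ = setT) ?preimage_setT//.
  rewrite -subTset => -[x y] _.
  have [i _ Fix] : (\bigcup_k F k) x by rewrite -TF.
  have [j _ Gjy] : (\bigcup_k G k) y by rewrite -TG.
  exists (maxn i j) => //; split => /=.
    by move: x Fix; exact/subsetPset/ndF/leq_maxl.
  by move: y Gjy; exact/subsetPset/ndG/leq_maxr.
move=> k; have [mF Fk] := Foo k; have [mG Gk] := Goo k; split.
  rewrite -[X in measurable X]setTI; apply: measurable_runcons0 => //.
  exact: measurableX.
rewrite /lebesgueS /pushforward -comp_preimage.
rewrite (_ : _ \o _ = id); last by apply/funext => x /=; rewrite rcons0K.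
by rewrite preimage_id product_measure1E// lte_mul_pinfty// ge0_fin_numE.
Qed.

HB.instance Definition _ :=
  Measure_isSigmaFinite.Build _ _ _ lebesgueS lebesgueS_sigma_finite.
End lebesgueS.

(* L^0 is the unit mass on the one-point space and L^(n+1) is the image of
   L^1 x L^n under (x_0, (x_1, .., x_n)) |-> (x_0, x_1, .., x_n). *)
Fixpoint lebesgueRn (n : nat) :
    {sigma_finite_measure set (borelRn R n) -> \bar R} :=
  if n is k.+1 then lebesgueS (lebesgueRn k) else \d_ ((0 : 'rV[R]_0) : borelRn R 0).

End borelRn.

Section hausdorff.
Context {R : realType} (n s : nat).

(* Arbitrary covering sets are allowed: on this type every set is measurable. *)
Let allsets := g_sigma_algebraType [set: set 'rV[R]_n].

Definition ediam (A : set 'rV[R]_n) : \bar R :=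
  ereal_sup [set (enorm (p.1 - p.2))%:E | p in A `*` A].

(* The factor, the volume of the unit ball of R^s over 2^s, normalizes the
   s-dimensional measure so that it is the classical s-dimensional area; sets of
   diameter more than [delta] are given size +oo to exclude them from covers. *)
Definition hausdorff_size (delta : R) (A : set 'rV[R]_n) : \bar R :=
  if A == set0 then 0%E
  else if (ediam A <= delta%:E)%E then
    (fine (lebesgueRn s (eball 0 1)) * (fine (ediam A) / 2) ^+ s)%:E
  else +oo%E.

Definition hausdorff_content (delta : R) (A : set 'rV[R]_n) : \bar R :=
  mu_ext (hausdorff_size delta : set allsets -> \bar R) A.

Definition hausdorff (A : set 'rV[R]_n) : \bar R :=
  ereal_sup [set hausdorff_content delta A | delta in [set r | 0 < r]].

Let hausdorff_size0 delta : hausdorff_size delta set0 = 0%E.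
Proof. by rewrite /hausdorff_size eqxx. Qed.

Let hausdorff_size_ge0 delta A : (0 <= hausdorff_size delta A)%E.
Proof.
rewrite /hausdorff_size; case: ifPn => // /set0P[x Ax]; case: ifPn => // _.
rewrite lee_fin mulr_ge0 ?fine_ge0 ?exprn_ge0 ?divr_ge0 ?fine_ge0//.
apply: ereal_sup_ubound; exists (x, x) => //=.
by rewrite subrr /enorm /dotv big1 ?sqrtr0// => i _; rewrite mxE mul0r.
Qed.

Let hausdorff0 : hausdorff set0 = 0%E.
Proof.
apply/eqP; rewrite eq_le; apply/andP; split.
  by apply: ge_ereal_sup => _ [d _ <-]; rewrite /hausdorff_content mu_ext0.
apply: ereal_sup_ubound; exists 1 => //=; exact: mu_ext0.
Qed.

Let hausdorff_ge0 A : (0 <= hausdorff A)%E.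
Proof.
apply: (@le_trans _ _ (hausdorff_content 1 A)); first exact: mu_ext_ge0.
by apply: ereal_sup_ubound; exists 1 => //=.
Qed.

Let le_hausdorff : {homo hausdorff : A B / A `<=` B >-> (A <= B)%E}.
Proof.
move=> A B AB; apply: ge_ereal_sup => _ [d d0 <-].
apply: (@le_trans _ _ (hausdorff_content d B)); first exact: le_mu_ext.
by apply: ereal_sup_ubound; exists d.
Qed.

Let hausdorff_sigma_subadditive : sigma_subadditive hausdorff.
Proof.
move=> F; apply: ge_ereal_sup => _ [d d0 <-].
apply: le_trans.
  apply: (@mu_ext_sigma_subadditive _ allsets R (hausdorff_size d)).
  exact: hausdorff_size_ge0.
have le1 i : (hausdorff_content d (F i) <= hausdorff (F i))%E.
  by apply: ereal_sup_ubound; exists d.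
by apply: lee_nneseries => [i _ _|i _]; [exact: mu_ext_ge0|exact: le1].
Qed.

HB.instance Definition _ := isOuterMeasure.Build R 'rV[R]_n hausdorff
  hausdorff0 hausdorff_ge0 le_hausdorff hausdorff_sigma_subadditive.

Definition hausdorff_outer : {outer_measure set 'rV[R]_n -> \bar R} := hausdorff.

Definition hausdorff_measure :
    {measure set (caratheodory_type hausdorff_outer) -> \bar R} :=
  hausdorff_outer.

End hausdorff.

Section volume.
Context {R : realType} {d : nat}.
Implicit Types (V : set 'rV[R]_d) (F nu : 'rV[R]_d -> 'rV[R]_d).

Definition divergence F (x : 'rV[R]_d) : R :=
  \sum_(j < d) 'D_(delta_mx ord0 j) (fun y => F y ord0 j) x.

Definition C1_field F : Prop :=
  (forall x, differentiable F x) /\ (forall v, continuous ('D_v F)).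

(* [w] is the unit exterior normal of [V] at [x] in the sense of Federer: up to
   a set of density 0 at [x], the set [V] lies on the side of the hyperplane
   through [x] orthogonal to [w] opposite to [w], and its complement lies on
   the side of [w].  At a boundary point where [V] is locally the subgraph of a
   differentiable function this is the classical outward unit normal. *)
Definition outward_unit_normal V (x w : 'rV[R]_d) : Prop :=
  [/\ enorm w = 1,
      fine (lebesgueRn d ((eball x r `&` V) `&` [set y | 0 < dotv (y - x) w]))
        / r ^+ d @[r --> 0^'+] --> (0 : R)
    & fine (lebesgueRn d ((eball x r `\` V) `&` [set y | dotv (y - x) w < 0]))
        / r ^+ d @[r --> 0^'+] --> (0 : R)].

Definition surface_measure := @hausdorff_measure R d d.-1.

Definition surface_type := caratheodory_type (@hausdorff_outer R d d.-1).

(* A set regular enough for the boundary integral, the outward normal and the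
   divergence theorem (for C^1 fields) to make sense; bounded Lipschitz domains
   with their outward unit normal are the standard example. *)
Record volume V nu : Prop := Volume {
  volume_bounded : bounded_set V;
  volume_measurable : measurable (V : set (borelRn R d));
  volume_perimeter : (surface_measure (boundary V) < +oo)%E;
  volume_measurable_normal : forall j : 'I_d,
    measurable_fun (boundary V : set surface_type) (fun x => nu x ord0 j);
  volume_normal : {ae surface_measure, forall x,
    boundary V x -> outward_unit_normal V x (nu x)};
  volume_divergence_theorem : forall F, C1_field F ->
    \int[lebesgueRn d]_(x in V) divergence F x =
    \int[surface_measure]_(x in boundary V) dotv (F x) (nu x)
}.

End volume.

Section mesh.
Context {R : realType} {d : nat}.
Implicit Types (Omega : set 'rV[R]_d) (v : 'I_d.+1 -> 'rV[R]_d).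

Definition domain Omega : Prop :=
  [/\ open Omega, connected Omega, Omega !=set0 & bounded_set Omega].

Definition affinely_independent v : bool :=
  (\matrix_(i < d, j < d) (v (lift ord0 i) ord0 j - v ord0 ord0 j)) \in unitmx.

Definition face v (I : set 'I_d.+1) : set 'rV[R]_d :=
  [set x | exists a : 'I_d.+1 -> R,
    [/\ forall i, 0 <= a i, \sum_i a i = 1,
        forall i, ~ I i -> a i = 0 & x = \sum_i a i *: v i]].

Definition simplex v : set 'rV[R]_d := face v setT.

Record mesh := Mesh {
  mesh_size : nat;
  mesh_vertex : 'I_mesh_size -> 'I_d.+1 -> 'rV[R]_d
}.

Implicit Type T : mesh.

Definition element T (k : 'I_(mesh_size T)) : set 'rV[R]_d :=
  simplex (mesh_vertex k).

(* In a conforming mesh two elements meet exactly in the face spanned by their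
   common vertices (possibly empty). *)
Record conforming_mesh Omega T : Prop := ConformingMesh {
  mesh_nondegenerate : forall k, affinely_independent (@mesh_vertex T k);
  mesh_nonoverlapping : forall k l : 'I_(mesh_size T), k != l ->
    interior (element k) `&` interior (element l) = set0;
  mesh_conforming : forall k l : 'I_(mesh_size T),
    element k `&` element l =
    face (mesh_vertex k)
      [set i | exists j, mesh_vertex l j = mesh_vertex k i];
  mesh_subdomain : forall k : 'I_(mesh_size T), interior (element k) `<=` Omega;
  mesh_cover : closure Omega = \bigcup_(k : 'I_(mesh_size T)) element k
}.

Definition polynomial_on (N : nat) (S : set 'rV[R]_d) (g : 'rV[R]_d -> R) :=
  exists2 p : mpoly.mpoly d R, (mpoly.msize p <= N.+1)%N
    & forall x, S x -> g x = mpoly.meval (x ord0) p.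

(* Scalar discontinuous piecewise polynomials: nothing is required on the
   interfaces, a null set, except Borel measurability. *)
Definition dg_space Omega T (N : nat) : set ('rV[R]_d -> R) :=
  [set g | measurable_fun (Omega : set (borelRn R d)) g /\
           forall k : 'I_(mesh_size T),
             polynomial_on N (interior (element k)) g].

Definition lagrange_space Omega T (N : nat) : set ('rV[R]_d -> R) :=
  [set g | {within closure Omega, continuous g} /\
           forall k : 'I_(mesh_size T), polynomial_on N (element k) g].

Definition componentwise (p q : nat) (X : set ('rV[R]_d -> R)) :
    set ('rV[R]_d -> 'M[R]_(p, q)) :=
  [set g | forall i j, X (fun x => g x i j)].

(* The principal lattice of order [N] of the [k]-th element. *)
Definition lagrange_node T (N : nat) (k : 'I_(mesh_size T)) : set 'rV[R]_d :=
  [set x | exists2 a : 'I_d.+1 -> nat, (\sum_i a i)%N = N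
         & x = \sum_i ((a i)%:R / N%:R) *: mesh_vertex k i].

Definition nodal_interpolant Omega T (N p q : nat)
    (g h : 'rV[R]_d -> 'M[R]_(p, q)) : Prop :=
  componentwise (lagrange_space Omega T N) h /\
  forall (k : 'I_(mesh_size T)) x, lagrange_node N k x -> h x = g x.

(* A linear map from the broken space into the continuous one that reproduces
   every continuous field already in the broken space.  The members of
   [dg_space] being functions rather than classes, the last item also expresses
   that values on the interfaces are irrelevant. *)
Definition projector Omega T (N m : nat)
    (P : ('rV[R]_d -> 'rV[R]_m) -> 'rV[R]_d -> 'rV[R]_m) : Prop :=
  let U := componentwise (dg_space Omega T N) in
  let W := componentwise (lagrange_space Omega T N.+1) in
  [/\ forall u, U u -> W (P u),
      forall (a : R) u w, U u -> U w -> forall x, closure Omega x ->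
        P (a *: u + w) x = a *: P u x + P w x
    & forall u w, U u -> W w ->
        (forall (k : 'I_(mesh_size T)) x, interior (element k) x -> u x = w x) ->
        forall x, closure Omega x -> P u x = w x].

End mesh.

(* The [i]-th row of [f q] is the flux of the [i]-th conserved variable; [D] is
   the set of admissible states. *)
Definition hyperbolic (R : realType) (m d : nat) (D : set 'rV[R]_m)
    (f : 'rV[R]_m -> 'M[R]_(m, d)) : Prop :=
  open D /\ forall q, D q -> differentiable f q /\
    forall w : 'rV[R]_d, diagonalizable (jacobian (fun p => w *m (f p)^T) q).

Section scheme.
Context {R : realType} {d m : nat}.
Variables (Omega : set 'rV[R]_d) (T : @mesh R d) (N : nat) (J : set R).

(* The time derivative of the coefficients of [u t], expressed pointwise in the
   elements. *)
Definition semidiscrete_solution (u : R -> 'rV[R]_d -> 'rV[R]_m)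
    (ftilde : R -> 'rV[R]_d -> 'M[R]_(m, d)) : Prop :=
  [/\ forall t, J t -> componentwise (dg_space Omega T N) (u t),
      forall t, J t -> forall (k : 'I_(mesh_size T)) x,
        interior (element k) x -> forall i : 'I_m,
        derivable (fun s => u s x ord0 i) t 1
    & forall t, J t -> forall (k : 'I_(mesh_size T)) (i : 'I_m)
        (phi : 'rV[R]_d -> R), dg_space Omega T N phi ->
        \int[lebesgueRn d]_(x in interior (element k))
          (phi x * derive1 (fun s => u s x ord0 i) t) +
        \int[lebesgueRn d]_(x in interior (element k))
          (phi x * divergence (fun y => row i (ftilde t y)) x) = 0].

End scheme.

(* Main.v *)
From HB Require Import structures.
Require Import Defs.
From mathcomp Require Import all_boot all_order all_algebra.
From mathcomp Require Import all_classical all_reals all_analysis.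
From mathcomp Require Import measurable_realfun ring lra.
From mathcomp Require mpoly.
Import (canonicals, coercions) mpoly.
Import Order.TTheory GRing.Theory Num.Theory.
Import numFieldNormedType.Exports.
Set Implicit Arguments.
Unset Strict Implicit.
Unset Printing Implicit Defensive.
Local Open Scope classical_set_scope.
Local Open Scope ring_scope.

(** The proof has three independent parts.

    The scheme holds pointwise.  On the interior of an element the state
    [u s] is a polynomial of degree at most [N], hence a combination of its
    values at finitely many points with fixed polynomial coefficients
    ([poly_interpolation]); so its time derivative is a polynomial of degree at
    most [N] as well ([time_derivative_nodes]).  The divergence of the flux,
    the derivative of a polynomial of degree at most [N.+1], has the same
    degree.  The residual of the two, extended by zero to the other elements,
    is therefore an admissible test function; testing the scheme with it shows
    that the integral of its square vanishes, and so the residual is zero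
    almost everywhere ([pint_square_free]).  Since the faces of the elements
    are null sets ([mesh_interiors_full]), the integral over [V] of the time
    derivative is minus that of the elementwise divergence, and the mass, a
    finite combination of point values of [u], may be differentiated in time.

    The divergence theorem extends from C^1 fields to the discrete flux
    ([boundary_flux]).  A regular volume satisfies it for fields that are C^1
    on the whole space, whereas the flux is only continuous, is defined on the
    closure of the domain, and its elementwise divergence jumps across the faces
    that [V] cuts.  Write [g] for a component of the flux, [p k] for the
    polynomial that it equals on the element [k], and [gap k] for the sum of the
    negative parts of the barycentric coordinates of [k], which vanishes
    exactly on [k].  On every element [l] the inequality
    [p k - p l <= C * gap k] holds for a large constant [C]: this is where the
    continuity of [g] and the conformity of the mesh are used
    ([vanishing_le_gap]).  Hence [g] is the maximum over [k] of the functions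
    [p k - C * gap k], which make sense on the whole space.  Replacing the
    maxima, including those in the negative parts, by the soft maximum
    [e * ln (\sum_k expR (h k / e))] yields smooth functions that converge to
    [g] as [e] tends to zero, and whose gradients, being convex combinations of
    the gradients of the competitors, stay bounded and converge to the
    gradient of [g] inside the elements ([lagrange_smoothing]).  Both sides of the
    divergence theorem then pass to the limit by bounded convergence.

    Bounded convergence on the boundary of [V] needs continuous functions to
    be measurable for the Hausdorff measure.  It suffices that the half-spaces
    [x_j <= a] satisfy the criterion of Caratheodory, which follows from the
    additivity of the Hausdorff measure on two sets whose [j]-th coordinates are
    a positive distance apart ([separated_caratheodory],
    [hausdorff_separated]). *)

(** * Polynomial functions and continuously differentiable functions *)

Lemma cvg_sumr {R : realType} (T : Type) (F : set_system T) {FF : Filter F}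
    (I : Type) (r : seq I) (P : pred I) (f : I -> T -> R) (l : I -> R) :
  (forall k, P k -> f k x @[x --> F] --> l k) ->
  \sum_(k <- r | P k) f k x @[x --> F] --> \sum_(k <- r | P k) l k.
Proof.
move=> fl; elim: r => [|k r IH].
  by under eq_fun do rewrite big_nil; rewrite big_nil; exact: cvg_cst.
under eq_fun do rewrite big_cons; rewrite big_cons.
by case: ifPn => // Pk; apply: cvgD => //; exact: fl.
Qed.

Lemma continuous_sumr {R : realType} (T : topologicalType) (I : Type)
    (r : seq I) (P : pred I) (f : I -> T -> R) :
  (forall k, P k -> continuous (f k)) ->
  continuous (fun x => \sum_(k <- r | P k) f k x).
Proof.
by move=> cf x; exact: (@cvg_sumr R T (nbhs x) _ _ _ _ _ _ (fun k Pk => cf k Pk x)).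
Qed.

Section polynomial_functions.
Context {R : realType} {d : nat}.
Notation mpol := (mpoly.mpoly d R).

Definition pev (p : mpol) (x : 'rV[R]_d) : R := mpoly.meval (x ord0) p.

(** Polynomial functions inherit any property of constants and coordinates that
    is stable under sums and products; monomials are never handled directly. *)
Lemma mpoly_ring_ind (Q : mpol -> Prop) :
  (forall c, Q (mpoly.mpolyC d c)) -> (forall i, Q (mpoly.mpolyX R (mpoly.mnm1 i))) ->
  (forall p q, Q p -> Q q -> Q (p + q)) ->
  (forall p q, Q p -> Q q -> Q (p * q)) -> forall p, Q p.
Proof.
move=> QC QX QD QM p; rewrite (mpoly.mpolyE p).
have Q1 : Q 1 by rewrite -mpoly.mpolyC1; exact: QC.
have Q0 : Q 0 by rewrite -mpoly.mpolyC0; exact: QC.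
apply: (big_ind Q) => // m _; rewrite -mpoly.mul_mpolyC; apply/(QM _ _ (QC _)).
rewrite mpoly.mpolyXE_id; apply: (big_ind Q) => [//||i _]; first exact: QM.
by elim: (m i) => [|k IH]; rewrite ?expr0// exprS; exact: QM.
Qed.

(** The candidate [dg v x] for the derivative of [g] at [x] along [v] is part of
    the predicate, so that gradients can be computed by composing lemmas. *)
Definition C1 (g : 'rV[R]_d -> R) (dg : 'rV[R]_d -> 'rV[R]_d -> R) : Prop :=
  [/\ forall x, differentiable g x, forall v x, 'D_v g x = dg v x
    & forall v, continuous (dg v)].

Lemma C1_continuous g dg : C1 g dg -> continuous g.
Proof. by move=> [dg1 _ _] x; apply/differentiable_continuous. Qed.
Arguments C1_continuous {g dg} _ x.

Lemma C1_derive g dg v x : C1 g dg -> is_derive x v g (dg v x).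
Proof.
by move=> [dg1 dg2 _]; rewrite -dg2; apply: derivableP; exact: diff_derivable.
Qed.

Lemma C1_cst c : C1 (fun=> c) (fun _ _ => 0).
Proof.
split=> [x|v x|v]; first exact: differentiable_cst.
  exact: derive_cst.
exact: cst_continuous.
Qed.

Lemma C1_coord (j : 'I_d) : C1 (fun x => x ord0 j) (fun v _ => v ord0 j).
Proof.
have D x : differentiable (fun x : 'rV[R]_d => x ord0 j) x.
  exact: differentiable_coord.
split=> // [v x|v]; last exact: cst_continuous.
rewrite deriveE//.
have lin : linear (fun x : 'rV[R]_d => x ord0 j : R) by move=> a y z; rewrite !mxE.
pose l := GRing.isLinear.Build _ _ _ _ _ lin.
pose L : {linear 'rV[R]_d -> R} := HB.pack (fun x : 'rV[R]_d => x ord0 j : R) l.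
have := @diff_lin _ _ _ L x; rewrite /= => ->//.
exact: coord_continuous.
Qed.

Lemma C1D f df g dg : C1 f df -> C1 g dg ->
  C1 (fun x => f x + g x) (fun v x => df v x + dg v x).
Proof.
move=> Cf Cg; have [f1 f2 f3] := Cf; have [g1 g2 g3] := Cg; split=> [x|v x|v x].
- exact: differentiableD.
- by have /@derive_val := is_deriveD (C1_derive v x Cf) (C1_derive v x Cg).
- exact: (cvgD (f3 v x) (g3 v x)).
Qed.

Lemma C1M f df g dg : C1 f df -> C1 g dg ->
  C1 (fun x => f x * g x) (fun v x => f x * dg v x + g x * df v x).
Proof.
move=> Cf Cg; have [f1 f2 f3] := Cf; have [g1 g2 g3] := Cg; split=> [x|v x|v x].
- exact: differentiableM.
- by have /@derive_val := is_deriveM (C1_derive v x Cf) (C1_derive v x Cg).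
- exact: (cvgD (cvgM (C1_continuous Cf x) (g3 v x))
               (cvgM (C1_continuous Cg x) (f3 v x))).
Qed.

Lemma C1_ext f df g dg : C1 f df -> (forall x, f x = g x) ->
  (forall v x, df v x = dg v x) -> C1 g dg.
Proof.
move=> C /funext <- E; rewrite (_ : dg = df)//.
by apply/funext => v; apply/funext => x; rewrite E.
Qed.

Lemma C1_sum (I : Type) (r : seq I) f df : (forall k, C1 (f k) (df k)) ->
  C1 (fun x => \sum_(k <- r) f k x) (fun v x => \sum_(k <- r) df k v x).
Proof.
move=> H; elim: r => [|k r IH].
  by apply: (C1_ext (C1_cst 0)) => *; rewrite big_nil.
by apply: (C1_ext (C1D (H k) IH)) => *; rewrite big_cons.
Qed.

Lemma C1_comp (phi dphi : R -> R) g dg : C1 g dg ->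
  (forall x, is_derive (g x) (1 : R) phi (dphi (g x))) ->
  (forall x, {for g x, continuous dphi}) ->
  C1 (fun x => phi (g x)) (fun v x => dphi (g x) * dg v x).
Proof.
move=> Cg phiP cphi; have [g1 g2 g3] := Cg.
have D x : differentiable phi (g x).
  by apply/derivable1_diffP; exact: (@ex_derive _ _ _ _ _ _ _ (phiP x)).
split=> [x|v x|v x].
- exact: differentiable_comp.
- rewrite deriveE; last exact: differentiable_comp.
  rewrite (_ : (fun x => phi (g x)) = phi \o g)// diff_comp//=.
  have -> : 'd g x v = dg v x by rewrite -deriveE// g2.
  rewrite -[dg v x]mulr1 -[X in 'd _ _ X]/(dg v x *: (1 : R)) linearZ/=.
  by rewrite -deriveE// derive_val mulr1 mulrC.
- have c := continuous_comp (C1_continuous Cg x) (cphi x).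
  exact: (cvgM c (g3 v x)).
Qed.

Lemma C1_pev p :
  C1 (pev p) (fun v x => \sum_(i < d) v ord0 i * pev (mpoly.mderiv i p) x).
Proof.
elim/mpoly_ring_ind: p => [c|i|p q Cp Cq|p q Cp Cq].
- apply: (C1_ext (C1_cst c)) => [x|v x]; first by rewrite /pev mpoly.mevalC.
  by rewrite big1// => i _; rewrite mpoly.mderivC /pev mpoly.meval0 mulr0.
- apply: (C1_ext (C1_coord i)) => [x|v x]; first by rewrite /pev mpoly.mevalXU.
  rewrite (bigD1 i)//= big1 ?addr0 => [|j ji]; rewrite mpoly.mderivX mpoly.mnm1E.
    have -> : mpoly.mnm_sub (mpoly.mnm1 i) (mpoly.mnm1 i) = mpoly.mnm0.
      by apply/mpoly.mnmP => k; rewrite mpoly.mnmBE subnn mpoly.mnm0E.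
    by rewrite eqxx scale1r mpoly.mpolyX0 /pev mpoly.meval1 mulr1.
  by rewrite eq_sym (negbTE ji) scale0r /pev mpoly.meval0 mulr0.
- apply: (C1_ext (C1D Cp Cq)) => [x|v x]; first by rewrite /pev mpoly.mevalD.
  rewrite -big_split/=; apply: eq_bigr => i _.
  by rewrite mpoly.mderivD /pev mpoly.mevalD mulrDr.
- apply: (C1_ext (C1M Cp Cq)) => [x|v x]; first by rewrite /pev mpoly.mevalM.
  rewrite !mulr_sumr -big_split/=; apply: eq_bigr => i _.
  rewrite mpoly.mderivM /pev mpoly.mevalD !mpoly.mevalM; ring.
Qed.

Lemma continuous_pev p : continuous (pev p).
Proof. exact: C1_continuous (C1_pev p). Qed.

Lemma coord_le_norm (x : 'rV[R]_d) i : `|x ord0 i| <= `|x|.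
Proof.
rewrite [leRHS]/Num.Def.normr/= mx_normrE; apply/bigmax_geP; right => /=.
by exists (ord0, i).
Qed.

(** The bound and the Lipschitz constant are proved together because the
    Lipschitz constant of a product involves the bounds of its factors. *)
Lemma pev_bounded_lipschitz p (M : R) : exists L : R, [/\ 0 <= L,
  forall x, `|x| <= M -> `|pev p x| <= L &
  forall x y, `|x| <= M -> `|y| <= M -> `|pev p x - pev p y| <= L * `|x - y|].
Proof.
elim/mpoly_ring_ind: p => [c|i|p q [L [L0 L1 L2]] [K [K0 K1 K2]]|p q [L [L0 L1 L2]] [K [K0 K1 K2]]].
- exists `|c|; split=> // [x _|x y _ _]; rewrite /pev !mpoly.mevalC//.
  by rewrite subrr normr0 mulr_ge0.
- exists (1 + `|M|); split=> [|x xM|x y _ _]; rewrite /pev ?mpoly.mevalXU.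
  + by rewrite addr_ge0.
  + rewrite (le_trans (coord_le_norm _ _))// (le_trans xM)//.
    by rewrite (le_trans (ler_norm _))// lerDr.
  + have -> : x ord0 i - y ord0 i = (x - y) ord0 i by rewrite !mxE.
    by rewrite (le_trans (coord_le_norm _ _))// ler_peMl// lerDl.
- exists (L + K); split=> [|x xM|x y xM yM]; rewrite ?addr_ge0// /pev !mpoly.mevalD.
    by rewrite (le_trans (ler_normD _ _))// lerD// ?L1 ?K1.
  rewrite opprD addrACA (le_trans (ler_normD _ _))// mulrDl lerD//; first exact: L2.
  exact: K2.
- exists (L * K + L * K + L * K); split=> [|x xM|x y xM yM].
  + by rewrite !addr_ge0// mulr_ge0.
  + rewrite /pev mpoly.mevalM normrM.
    apply: (@le_trans _ _ (L * K)); first by apply: ler_pM => //; [exact: L1|exact: K1].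
    by rewrite lerDr addr_ge0// mulr_ge0.
  + rewrite /pev !mpoly.mevalM -!/(pev _ _).
    have -> : pev p x * pev q x - pev p y * pev q y =
      pev p x * (pev q x - pev q y) + (pev p x - pev p y) * pev q y by ring.
    rewrite (le_trans (ler_normD _ _))// !normrM.
    have h1 : `|pev p x| * `|pev q x - pev q y| <= L * (K * `|x - y|).
      by apply: ler_pM => //; [exact: L1|exact: K2].
    have h2 : `|pev p x - pev p y| * `|pev q y| <= (L * `|x - y|) * K.
      by apply: ler_pM => //; [exact: L2|exact: K1].
    apply: (le_trans (lerD h1 h2)).
    rewrite -subr_ge0 (_ : _ - _ = L * K * `|x - y|); last by ring.
    by rewrite !mulr_ge0.
Qed.

Lemma msize_mderiv_le (p : mpol) i k : (mpoly.msize p <= k.+1)%N ->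
  (mpoly.msize (mpoly.mderiv i p) <= k)%N.
Proof.
move=> pk; rewrite mpoly.msizeE; apply/bigmax_leqP_seq => m mp _.
have : mpoly.mnm_add m (mpoly.mnm1 i) \in mpoly.msupp p.
  rewrite mpoly.mcoeff_msupp; apply: contraTneq mp => pm.
  by rewrite mpoly.mcoeff_msupp mpoly.mcoeff_mderiv pm mul0rn eqxx.
move=> /mpoly.msize_mdeg_lt; rewrite mpoly.mdegD mpoly.mdeg1 addn1.
by move=> /leq_trans/(_ pk).
Qed.

End polynomial_functions.

(** * Lebesgue measure: bounded sets and hyperplanes *)

Section lebesgue_space.
Context {R : realType}.

Lemma open_measurable_Rn n (U : set 'rV[R]_n) : open U ->
  measurable (U : set (borelRn R n)).
Proof. exact: sub_sigma_algebra. Qed.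

Lemma closed_measurable_Rn n (C : set 'rV[R]_n) : closed C ->
  measurable (C : set (borelRn R n)).
Proof.
move=> cC; rewrite -(setCK C); apply: measurableC; apply: open_measurable_Rn.
exact: closed_openC.
Qed.

Lemma continuous_measurable_Rn n (g : 'rV[R]_n -> R) : continuous g ->
  measurable_fun [set: borelRn R n] (g : borelRn R n -> R).
Proof.
move=> cg; apply: (measurability _ (RGenOpens.measurableE R)).
move=> _ [_ [a [b ->]] <-]; rewrite setTI; apply: open_measurable_Rn.
by apply: open_comp => [x _|]; [exact: cg|exact: interval_open].
Qed.

Definition hyperplane n (c : 'rV[R]_n) (b : R) : set 'rV[R]_n :=
  [set x | dotv x c = b].

Lemma continuous_dotv n (c : 'rV[R]_n) : continuous (fun x => dotv x c).
Proof.
apply: (@C1_continuous _ _ _ (fun v x => \sum_i (v ord0 i * c ord0 i))).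
apply: C1_sum => i; apply: (C1_ext (C1M (C1_coord i) (C1_cst (c ord0 i)))) => //.
by move=> v x; rewrite mulr0 add0r mulrC.
Qed.

Lemma measurable_hyperplane n (c : 'rV[R]_n) b :
  measurable (hyperplane c b : set (borelRn R n)).
Proof.
rewrite -[X in measurable X]setTI.
exact: (continuous_measurable_Rn (@continuous_dotv n c) measurableT (measurable_set1 b)).
Qed.

Lemma dotv_rcons0 n (x : R) (y : 'rV[R]_n) (c : 'rV[R]_n.+1) :
  dotv (rcons0 (x, y)) c =
  x * c ord0 ord0 + dotv y (\row_i c ord0 (lift ord0 i)).
Proof.
rewrite /dotv big_ord_recl; congr (_ + _).
  by rewrite /rcons0 mxE; case: splitP => // j _; rewrite mxE.
apply: eq_bigr => i _; rewrite [in RHS]mxE; congr (_ * _).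
rewrite /rcons0 mxE; case: splitP => [j|k]; first by rewrite (ord1 j).
by rewrite lift0 add1n => -[/val_inj ->].
Qed.

(** By slicing along the first coordinate: the slices are hyperplanes one
    dimension lower, null by induction, unless only the first coordinate occurs
    in the equation; then the hyperplane is a point times the whole space. *)
Lemma lebesgue_hyperplane n (c : 'rV[R]_n) b : c != 0 ->
  lebesgueRn n (hyperplane c b) = 0%E.
Proof.
elim: n c b => [|n IH] c b c0; first by rewrite thinmx0 eqxx in c0.
rewrite /= /lebesgueS /pushforward.
pose c' := \row_i c ord0 (lift ord0 i).
have [c'0|c'0] := eqVneq c' 0.
  have c00 : c ord0 ord0 != 0.
    apply: contra c0 => /eqP c00; apply/eqP/rowP => j; rewrite mxE.
    have [k ->|->] := unliftP ord0 j => //.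
    by have /rowP/(_ k) := c'0; rewrite !mxE.
  rewrite (_ : _ @^-1` _ = [set b / c ord0 ord0] `*` setT).
    rewrite product_measure1E// [X in (X * _)%E](_ : _ = 0%E) ?mul0e//.
    exact: lebesgue_measure_set1.
  have d0 (y : 'rV[R]_n) : dotv y c' = 0.
    by rewrite c'0 /dotv big1// => i _; rewrite mxE mulr0.
  apply/seteqP; split=> -[x y] /=; rewrite /hyperplane/= dotv_rcons0 d0 addr0.
    by move=> <-; rewrite mulfK.
  by move=> [-> _]; rewrite mulfVK.
rewrite /product_measure1; apply: integral0_eq => x _ /=.
rewrite (_ : xsection _ _ = hyperplane c' (b - x * c ord0 ord0)) ?IH//.
apply/seteqP; split=> y; rewrite /xsection/= inE /hyperplane/= dotv_rcons0.
  by move=> <-; rewrite addrAC subrr add0r.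
by rewrite /c' => ->; rewrite addrCA subrr addr0.
Qed.

Definition cube n (M : R) : set 'rV[R]_n := [set x | forall i, `|x ord0 i| <= M].

Lemma closed_cube n M : closed (@cube n M).
Proof.
rewrite (_ : cube _ = \bigcap_(i in [set: 'I_n]) [set x : 'rV[R]_n | `|x ord0 i| <= M]).
  apply: closed_bigI => i _.
  have c : continuous (fun x : 'rV[R]_n => `|x ord0 i|).
    move=> x; apply: (continuous_comp _ (@norm_continuous _ _ _)).
    exact: coord_continuous.
  by have := preimage_closed (fun x _ => c x) (@closed_le R M).
by apply/seteqP; split=> x /= h i; [move=> _|]; exact: h.
Qed.

Lemma measurable_cube n M : measurable (@cube n M : set (borelRn R n)).
Proof. by apply: closed_measurable_Rn; exact: closed_cube. Qed.

Lemma lebesgue_cube n M : (lebesgueRn n (cube M) < +oo)%E.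
Proof.
elim: n => [|n IH].
  by rewrite /= diracE; case: (_ \in _); rewrite ltry.
rewrite /= /lebesgueS /pushforward.
apply: (@le_lt_trans _ _
  ((@lebesgue_measure R \x lebesgueRn n)%E (`[(-M), M] `*` cube M))).
  apply: le_measure; rewrite ?inE.
  - rewrite -[X in measurable X]setTI; apply: measurable_rcons0 => //.
    exact: measurable_cube.
  - by apply: measurableX => //; exact: measurable_cube.
  - move=> [x y] /= H; split=> /=.
      have := H ord0; rewrite /rcons0 mxE; case: splitP => // j _.
      by rewrite mxE/= in_itv/= -ler_norml.
    move=> i; have := H (lift ord0 i); rewrite /rcons0 mxE; case: splitP => [j|k].
      by rewrite (ord1 j).
    by rewrite lift0 add1n => -[/val_inj ->].
rewrite product_measure1E//; last exact: measurable_cube.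
have fin : lebesgue_measure (`[- M, M]%classic : set R) \is a fin_num.
  by rewrite lebesgue_measure_itv/=; case: ifP.
exact: lte_mul_pinfty.
Qed.

Lemma bounded_lebesgue_finite n (A : set 'rV[R]_n) : bounded_set A ->
  measurable (A : set (borelRn R n)) -> (lebesgueRn n A < +oo)%E.
Proof.
move=> [M [Mr AM]] mA; apply: le_lt_trans (lebesgue_cube n (M + 1)).
apply: le_measure; rewrite ?inE//; first exact: measurable_cube.
move=> x Ax i; apply: (le_trans (coord_le_norm _ _)).
by apply: AM => //; rewrite ltrDl.
Qed.

End lebesgue_space.

(** * Barycentric coordinates *)

Section barycentric.
Context {R : realType} {d : nat}.
Implicit Types (v : 'I_d.+1 -> 'rV[R]_d) (x y : 'rV[R]_d).

Lemma dotvDl n (x y c : 'rV[R]_n) : dotv (x + y) c = dotv x c + dotv y c.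
Proof. by rewrite /dotv -big_split/=; apply: eq_bigr => i _; rewrite mxE mulrDl. Qed.

Lemma dotvZl n a (x c : 'rV[R]_n) : dotv (a *: x) c = a * dotv x c.
Proof. by rewrite /dotv mulr_sumr; apply: eq_bigr => i _; rewrite mxE mulrA. Qed.

Lemma dotv0l n (c : 'rV[R]_n) : dotv 0 c = 0.
Proof. by rewrite /dotv big1// => i _; rewrite mxE mul0r. Qed.

Lemma dotvC n (x y : 'rV[R]_n) : dotv x y = dotv y x.
Proof. by apply: eq_bigr => i _; rewrite mulrC. Qed.

Lemma dotv_suml n (I : Type) (r : seq I) (P : pred I) (f : I -> 'rV[R]_n) c :
  dotv (\sum_(i <- r | P i) f i) c = \sum_(i <- r | P i) dotv (f i) c.
Proof.
elim/big_rec2 : _ => [|i y1 y2 _ <-]; first exact: dotv0l.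
exact: dotvDl.
Qed.

Lemma dotvBl n (x y c : 'rV[R]_n) : dotv (x - y) c = dotv x c - dotv y c.
Proof. by rewrite dotvDl -scaleN1r dotvZl mulN1r. Qed.

Definition edges v : 'M[R]_d :=
  \matrix_(i < d, j < d) (v (lift ord0 i) ord0 j - v ord0 ord0 j).

(** For [i > 0] the [i]-th barycentric coordinate of [x] is the coordinate of
    [x - v ord0] on the [i]-th edge from [v ord0], read from the inverse of the
    edge matrix; the coordinate of index [0] is one minus the sum of the others. *)
Definition bary_grad v (i : 'I_d.+1) : 'rV[R]_d :=
  if unlift ord0 i is Some j then (col j (invmx (edges v)))^T
  else - \sum_(j < d) (col j (invmx (edges v)))^T.

Definition bary v i x : R := (i == ord0)%:R + dotv (x - v ord0) (bary_grad v i).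

Lemma bary_lift v j x :
  bary v (lift ord0 j) x = ((x - v ord0) *m invmx (edges v)) ord0 j.
Proof.
rewrite /bary eq_sym (negbTE (neq_lift _ _)) add0r /bary_grad liftK /dotv mxE.
by apply: eq_bigr => i _; rewrite !mxE.
Qed.

Lemma bary_sum1 v x : \sum_i bary v i x = 1.
Proof.
rewrite big_ord_recl.
under eq_bigr do rewrite /bary eq_sym (negbTE (neq_lift _ _)) add0r /bary_grad liftK dotvC.
rewrite -dotv_suml /bary eqxx /bary_grad unlift_none dotvC -addrA -dotvDl.
by rewrite addNr dotv0l addr0.
Qed.

Lemma baryE v (a : 'I_d.+1 -> R) x : affinely_independent v ->
  \sum_i a i = 1 -> x = \sum_i a i *: v i -> forall i, bary v i x = a i.
Proof.
move=> ai a1 xE.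
have lift_eq j : bary v (lift ord0 j) x = a (lift ord0 j).
  rewrite bary_lift (_ : x - v ord0 = (\row_k a (lift ord0 k)) *m edges v).
    by rewrite mulmxK// mxE.
  rewrite xE -[v ord0 in LHS]scale1r -a1 scaler_suml -sumrB big_ord_recl subrr add0r.
  apply/rowP => k; rewrite summxE mxE; apply: eq_bigr => i _.
  by rewrite !mxE mulrBr.
move=> i; have [j ->//|->] := unliftP ord0 i.
have := bary_sum1 v x; rewrite -a1 !big_ord_recl.
by under eq_bigr do rewrite lift_eq; move/addIr.
Qed.

Lemma bary_comb v x : affinely_independent v -> x = \sum_i bary v i x *: v i.
Proof.
move=> ai.
have -> : \sum_i bary v i x *: v i =
    \sum_i bary v i x *: (v i - v ord0) + v ord0.
  rewrite -[X in _ = _ + X]scale1r -(bary_sum1 v x) scaler_suml -big_split/=.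
  by apply: eq_bigr => i _; rewrite scalerBr subrK.
rewrite big_ord_recl subrr scaler0 add0r.
have -> : \sum_(i < d) bary v (lift ord0 i) x *: (v (lift ord0 i) - v ord0) =
    (x - v ord0) *m invmx (edges v) *m edges v.
  apply/rowP => k; rewrite summxE !mxE; apply: eq_bigr => i _.
  by rewrite bary_lift [edges v i k]mxE !mxE.
by rewrite mulmxKV// subrK.
Qed.

Lemma bary_affine v (I : finType) (a : I -> R) (w : I -> 'rV[R]_d) i :
  \sum_k a k = 1 ->
  bary v i (\sum_k a k *: w k) = \sum_k a k * bary v i (w k).
Proof.
move=> a1; have sumE (b : R) : b = \sum_k a k * b by rewrite -mulr_suml a1 mul1r.
have -> : bary v i (\sum_k a k *: w k) =
    (i == ord0)%:R + dotv (\sum_k a k *: (w k - v ord0)) (bary_grad v i).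
  rewrite /bary; congr (_ + dotv _ _).
  rewrite -[X in _ - X]scale1r -a1 scaler_suml -sumrB.
  by apply: eq_bigr => k _; rewrite scalerBr.
rewrite [(i == ord0)%:R]sumE dotv_suml -big_split/=.
by apply: eq_bigr => k _; rewrite dotvZl -mulrDr.
Qed.

Lemma bary_affine2 v i a x y : bary v i ((1 - a) *: x + a *: y) =
  (1 - a) * bary v i x + a * bary v i y.
Proof.
have E : (1 - a) *: x + a *: y - v ord0 =
    (1 - a) *: (x - v ord0) + a *: (y - v ord0).
  rewrite !scalerBr addrACA -opprD; congr (_ - _).
  by rewrite -scalerDl subrK scale1r.
by rewrite /bary E [in LHS]dotvDl ![in LHS]dotvZl; ring.
Qed.

Lemma bary_vertex v i j : affinely_independent v -> bary v i (v j) = (i == j)%:R.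
Proof.
move=> ai; apply: (baryE (a := fun i => (i == j)%:R)) => //.
  by rewrite (bigD1 j)//= eqxx big1 ?addr0// => k /negbTE ->.
by rewrite (bigD1 j)//= eqxx scale1r big1 ?addr0// => k /negbTE ->; rewrite scale0r.
Qed.

Lemma C1_bary v i : C1 (bary v i) (fun w _ => dotv w (bary_grad v i)).
Proof.
have C : C1 (fun x => \sum_(j < d) x ord0 j * bary_grad v i ord0 j)
    (fun w _ => \sum_(j < d) w ord0 j * bary_grad v i ord0 j).
  apply: C1_sum => j; apply: (C1_ext (C1M (C1_coord j) (C1_cst _))) => // w x.
  by rewrite mulr0 add0r mulrC.
apply: (C1_ext (C1D (C1_cst ((i == ord0)%:R - dotv (v ord0) (bary_grad v i))) C)).
  by move=> x; rewrite /bary dotvBl addrAC addrA.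
by move=> w x; rewrite add0r.
Qed.

Lemma continuous_bary v i : continuous (bary v i).
Proof. exact: C1_continuous (C1_bary v i). Qed.

Lemma faceP v (I : set 'I_d.+1) x : affinely_independent v ->
  face v I x <-> (forall i, 0 <= bary v i x) /\ (forall i, ~ I i -> bary v i x = 0).
Proof.
move=> ai; split=> [[a [a0 a1 aI xE]]|[b0 bI]].
  by have bE := baryE ai a1 xE; split=> i; rewrite bE//; exact: aI.
by exists (fun i => bary v i x); split=> //; [exact: bary_sum1|exact: bary_comb].
Qed.

Lemma simplexP v x : affinely_independent v ->
  simplex v x <-> forall i, 0 <= bary v i x.
Proof.
by move=> ai; rewrite /simplex (faceP setT x ai); split=> [[]//|b0]; split=> // i; case.
Qed.

(** A coordinate cannot vanish at an interior point [x]: it would be negative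
    after a small step from [x] away from the vertex [v i]. *)
Lemma interior_simplexP v x : affinely_independent v ->
  interior (simplex v) x <-> forall i, 0 < bary v i x.
Proof.
move=> ai; split=> [ix i|b0]; last first.
  have : \forall y \near x, forall i, 0 < bary v i y.
    apply: (@filter_forall _ _ (fun i y => 0 < bary v i y) (nbhs x)) => i.
     have c := @continuous_bary v i x.
    exact: (cvgr_gt _ c 0 (b0 i)).
  by apply: filterS => y yb; apply/simplexP => // i; exact/ltW.
have b0 := (simplexP x ai).1 (interior_subset ix) i.
rewrite lt_neqAle b0 andbT eq_sym; apply/negP => /eqP bi0.
pose g (t : R) := (1 - (- t)) *: x + (- t) *: v i.
have cg : g t @[t --> (0 : R)] --> x.
  rewrite [X in _ --> X](_ : _ = g 0); last by rewrite /g oppr0 subr0 scale1r scale0r addr0.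
  apply: cvgD; apply: cvgZr_tmp.
    by apply: cvgB; [exact: cvg_cst|apply: cvgN; exact: cvg_id].
  by apply: cvgN; exact: cvg_id.
have /nbhs_ballP[e/= e0 he] := cg _ ix.
have /he : ball 0 e (e / 2).
  by rewrite /ball/= sub0r normrN gtr0_norm ?divr_gt0// ltr_pdivrMr// ltr_pMr// ltr1n.
move=> /(simplexP _ ai)/(_ i); rewrite bary_affine2 bi0 bary_vertex// eqxx mulr0 add0r mulr1.
by rewrite oppr_ge0 leNgt divr_gt0.
Qed.

End barycentric.

(** * Two elements of a conforming mesh *)

Section simplex_geometry.
Context {R : realType} {d : nat}.
Implicit Types (v A B : 'I_d.+1 -> 'rV[R]_d) (x y w : 'rV[R]_d).

Lemma vertex_bary_le1 v i x : affinely_independent v -> simplex v x -> bary v i x <= 1.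
Proof.
move=> ai /(simplexP _ ai) b0; rewrite -(bary_sum1 v x) (bigD1 i)//= lerDl.
by apply: sumr_ge0 => j _.
Qed.

Lemma closed_bary_ge0 v i : closed [set x | 0 <= bary v i x].
Proof.
have c := preimage_closed (fun x _ => @continuous_bary _ _ v i x) (@closed_ge R 0).
exact: c.
Qed.

Lemma closed_bary_eq0 v i : closed [set x | bary v i x = 0].
Proof.
have c := preimage_closed (fun x _ => @continuous_bary _ _ v i x) (@closed_eq R 0).
exact: c.
Qed.

Lemma closed_simplex v : affinely_independent v -> closed (simplex v).
Proof.
move=> ai; rewrite (_ : simplex v = \bigcap_(i in setT) [set x | 0 <= bary v i x]).
  by apply: closed_bigI => i _; exact: closed_bary_ge0.
by apply/seteqP; split=> x /=; [move=> /(simplexP _ ai) h i _; exact: h|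
  move=> h; apply/(simplexP _ ai) => i; exact: h].
Qed.

Lemma simplex_norm_le v x : affinely_independent v -> simplex v x ->
  `|x| <= \sum_i `|v i|.
Proof.
move=> ai sx; rewrite {1}(bary_comb x ai) (le_trans (ler_norm_sum _ _ _))//.
apply: ler_sum => i _; rewrite normrZ ger0_norm ?(simplexP _ ai).1//.
by rewrite ler_piMl// vertex_bary_le1.
Qed.

Lemma simplex_comb v (a : 'I_d.+1 -> R) : (forall i, 0 <= a i) ->
  \sum_i a i = 1 -> simplex v (\sum_i a i *: v i).
Proof. by move=> a0 a1; exists a; split=> // i; case. Qed.

Lemma bary_grad_neq0 v i : (0 < d)%N -> affinely_independent v -> bary_grad v i != 0.
Proof.
move=> d0 ai; apply/eqP => g0.
have [j ji] : exists j, j != i.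
  have [->|?] := eqVneq i ord0; last by exists ord0; rewrite eq_sym.
  by exists (lift ord0 (Ordinal d0)); rewrite eq_sym neq_lift.
have : bary v i (v i) = bary v i (v j).
  by rewrite /bary g0 ![dotv _ 0]dotvC !dotv0l.
by rewrite !bary_vertex// eqxx eq_sym (negbTE ji) => /eqP; rewrite oner_eq0.
Qed.

Lemma negligible_bigcup_fin (disp : measure_display) (T : sigmaRingType disp)
  (mu : {measure set T -> \bar R}) (I : finType) (F : I -> set T) :
  (forall i, mu.-negligible (F i)) -> mu.-negligible (\bigcup_i F i).
Proof.
move=> nF; rewrite (_ : [set: I] = [set` enum I]); last first.
  by apply/seteqP; split=> // i _; rewrite /= mem_enum.
rewrite bigcup_seq; elim/big_ind : _ => //; first exact: negligible_set0.
by move=> X Y; exact: negligibleU.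
Qed.

(** A point of the simplex that is not interior has a zero barycentric
    coordinate, so it lies on one of finitely many hyperplanes. *)
Lemma simplex_frontier_null v : (0 < d)%N -> affinely_independent v ->
  (lebesgueRn d).-negligible (simplex v `\` interior (simplex v)).
Proof.
move=> d0 ai.
pose H (i : 'I_d.+1) := hyperplane (bary_grad v i)
  (dotv (v ord0) (bary_grad v i) - (i == ord0)%:R).
have nH : (lebesgueRn d).-negligible (\bigcup_i H i).
  apply: negligible_bigcup_fin => i.
  exists (H i); split=> //; first exact: measurable_hyperplane.
  by apply: lebesgue_hyperplane; exact: bary_grad_neq0.
apply: (negligibleS _ nH) => x [sx nix].
have [i bi0] : exists i, bary v i x = 0.
  apply: contra_notP nix => nb; apply/(interior_simplexP x ai) => i.
  rewrite lt_neqAle ((simplexP x ai).1 sx) andbT eq_sym; apply/eqP => b0.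
  by apply: nb; exists i.
exists i => //; move: bi0; rewrite /H /hyperplane /bary dotvBl/=; lra.
Qed.

(** A piecewise affine substitute for the distance from [x] to the simplex. *)
Definition exterior_gap A x : R := \sum_i Num.max 0 (- bary A i x).

Section conforming_pair.
Variables A B : 'I_d.+1 -> 'rV[R]_d.
Hypotheses (aiA : affinely_independent A) (aiB : affinely_independent B).
Hypothesis conf : simplex B `&` simplex A =
  face B [set i | exists j, A j = B i].

Let IB i := [exists j, A j == B i].
Let IA j := [exists i, A j == B i].

Let confP x : simplex B x -> simplex A x -> forall i, ~~ IB i -> bary B i x = 0.
Proof.
move=> Bx Ax i /existsPn nI.
have : face B [set i | exists j, A j = B i] x by rewrite -conf.
by move=> /(faceP _ _ aiB)[_]; apply=> -[j /eqP]; rewrite (negbTE (nI j)).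
Qed.

Let confA x : simplex B x -> (forall i, ~~ IB i -> bary B i x = 0) -> simplex A x.
Proof.
move=> Bx bx; suff [] : (simplex B `&` simplex A) x by [].
rewrite conf; apply/(faceP _ _ aiB); split=> [i|i nI]; first exact: (simplexP x aiB).1.
by apply: bx; apply/existsPn => j; apply/eqP => AB; apply: nI; exists j.
Qed.

(* The part of the gap that comes from the coordinates of [A] at the vertices
   that are not shared; it is homogeneous with respect to the common face. *)
Let gap x : R := \sum_(j | ~~ IA j) Num.max 0 (- bary A j x).

Let gap_le x : gap x <= exterior_gap A x.
Proof.
rewrite /exterior_gap (bigID IA)/= lerDr sumr_ge0// => j _.
by rewrite le_max lexx.
Qed.

(* [far] is the face of [B] opposite to the common face. *)
Let far w := simplex B w /\ forall i, IB i -> bary B i w = 0.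

(* If the gap vanished at [w], moving slightly from the barycentre of the
   common face towards [w] would stay in both simplices, hence by conformity
   in the common face, although the weight of [w] is entirely on the other
   vertices of [B].  When no vertex is shared, [w] itself would be common to
   simplices that do not meet. *)
Let gap_gt0 w : far w -> 0 < gap w.
Proof.
move=> [Bw bw].
have max0 (r : R) : 0 <= Num.max 0 r by rewrite le_max lexx.
rewrite lt_neqAle sumr_ge0 ?andbT//; apply/negP => /eqP/esym/eqP.
rewrite psumr_eq0// => /allP/= gw0.
have Aw0 j : ~~ IA j -> 0 <= bary A j w.
  move=> nj; have := gw0 j (mem_index_enum _); rewrite nj/= => /eqP m0.
  have : - bary A j w <= Num.max 0 (- bary A j w) by rewrite le_max lexx orbT.
  by rewrite m0 oppr_le0.
suff [e [y [e0 By Ay yE]]] : exists e y, [/\ e != 0, simplex B y, simplex A y &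
    forall i, ~~ IB i -> bary B i y = e * bary B i w].
  have all0 i : bary B i w = 0.
    have [/bw//|nI] := boolP (IB i).
    have := confP By Ay nI; rewrite (yE _ nI) => /eqP.
    by rewrite mulf_eq0 (negbTE e0) => /eqP.
  have /eqP := bary_sum1 B w; rewrite big1 => [|i _]; last exact: all0.
  by rewrite eq_sym oner_eq0.
have [noI|] := boolP [forall j, ~~ IA j].
  exists 1, w; split=> //; rewrite ?oner_eq0//.
    by apply/(simplexP _ aiA) => j; apply: Aw0; exact: (forallP noI).
  by move=> i _; rewrite mul1r.
rewrite negb_forall => /existsP[j0]; rewrite negbK => Ij0.
(* All the coordinates of the barycentre [c] at shared vertices are [1 / m]; this
   leaves room for the negative coordinates that [w] may have there. *)
pose m : R := \sum_j (IA j)%:R.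
have m0 : 0 < m.
  apply: (@lt_le_trans _ _ 1); rewrite ?ltr01// /m (bigD1 j0)//= Ij0 lerDl.
  by apply: sumr_ge0 => j _; rewrite ler0n.
pose a j : R := (IA j)%:R / m.
have a_ge0 j : 0 <= a j by rewrite divr_ge0 ?ler0n// ltW.
have a1 : \sum_j a j = 1 by rewrite -mulr_suml divff// gt_eqF.
pose c := \sum_j a j *: A j.
have cA j : bary A j c = a j by exact: (baryE aiA a1).
have AB j : IA j -> exists i, A j = B i.
  by move=> /existsP[i /eqP]; exists i.
have bAB i j : 0 <= a j * bary B i (A j) /\ (~~ IB i -> a j * bary B i (A j) = 0).
  rewrite /a; case IAj : (IA j); last by rewrite !mul0r.
  have [k ABk] := AB _ IAj; rewrite ABk (bary_vertex _ _ aiB); split.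
    by rewrite mulr_ge0 ?ler0n// divr_ge0 ?ler0n// ltW.
  move=> /existsPn nI; case: eqP => [ik|]; last by rewrite mulr0.
  by have := nI j; rewrite ik ABk eqxx.
have cB i : 0 <= bary B i c.
  by rewrite bary_affine// sumr_ge0// => j _; have [] := bAB i j.
have cB0 i : ~~ IB i -> bary B i c = 0.
  by move=> nI; rewrite bary_affine// big1// => j _; have [_ ->] := bAB i j.
pose M := \sum_j `|bary A j w|.
have M0 : 0 <= M by exact: sumr_ge0.
have MP j : - bary A j w <= M.
  rewrite /M (bigD1 j)//= (le_trans (ler_norm _))// normrN lerDl.
  exact: sumr_ge0.
have D0 : 0 < 1 + m * M by rewrite ltr_pwDl// mulr_ge0// ltW.
(* This value of [e] solves [(1 - e) / m = e * M]. *)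
pose e := (1 + m * M)^-1.
have e0 : 0 < e by rewrite invr_gt0.
have e1 : e <= 1.
  by rewrite invf_le1// lerDl mulr_ge0// ltW.
have eE : 1 - e = e * m * M.
  have eD : e * (1 + m * M) = 1 by rewrite mulVf// lt0r_neq0.
  by rewrite -[X in X - _]eD; ring.
exists e, ((1 - e) *: c + e *: w); split.
- exact: lt0r_neq0.
- apply/(simplexP _ aiB) => i; rewrite bary_affine2 addr_ge0// mulr_ge0 ?subr_ge0 ?(ltW e0)//.
  exact: (simplexP w aiB).1.
- apply/(simplexP _ aiA) => j; rewrite bary_affine2 cA.
  have [Ij|nj] := boolP (IA j); last first.
    by rewrite addr_ge0// mulr_ge0 ?subr_ge0 ?(ltW e0)//; exact: Aw0.
  have E (b : R) : e * m * M * (1 / m) + e * b = e * (M + b).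
    by rewrite mul1r mulrAC mulfK ?mulrDr// lt0r_neq0.
  rewrite /a Ij eE E.
  by rewrite mulr_ge0 ?(ltW e0)// -[bary A j w]opprK subr_ge0.
- by move=> i nI; rewrite bary_affine2 cB0// mulr0 add0r.
Qed.

Let continuous_gap : continuous gap.
Proof.
apply: continuous_sumr => j _ x.
have cb : {for x, continuous (fun x => - bary A j x)}.
  by apply: continuousN; exact: continuous_bary.
exact: (continuous_max (@cst_continuous _ _ 0 x) cb).
Qed.

(* The opposite face is compact. *)
Let gap_ge : (0 < d)%N -> exists2 c, 0 < c & forall w, far w -> c <= gap w.
Proof.
move=> d0; have [F0|/set0P F0] := eqVneq far set0.
  by exists 1 => // w; rewrite F0.
have cF : compact far.
  apply: bounded_closed_compact.
    exists (\sum_i `|B i|); split; first exact: num_real.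
    by move=> M M1 x [Bx _]; apply: le_trans (ltW M1); exact: simplex_norm_le.
  rewrite (_ : far = simplex B `&` \bigcap_(i in [set i | IB i]) [set x | bary B i x = 0]).
    by apply: closedI; [exact: closed_simplex|apply: closed_bigI => i _; exact: closed_bary_eq0].
  by [].
have [w /set_mem Fw wP] := compact_EVT_min F0 cF (continuous_subspaceT continuous_gap).
by exists (gap w); [exact: gap_gt0|move=> y Fy; apply: wP; exact/mem_set].
Qed.

(** Let [s] be the sum of the coordinates of [x] at the vertices of [B] that are
    not shared.  Then [x] is at distance at most a multiple of [s] from the
    common face, where [q] vanishes, so [q x] is at most a multiple of [s]; when
    no vertex is shared, [s] is one and the bound on [q] suffices.
    On the other hand, [x] is the barycentre of a point of the common face with
    weight [1 - s] and of a point [w] of the opposite face with weight [s], and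
    the relevant coordinates of [A] vanish on the common face, so that the gap
    at [x] is at least [s] times the gap at [w], which is bounded below. *)
Lemma vanishing_le_gap (q : 'rV[R]_d -> R) (L : R) : (0 < d)%N -> 0 <= L ->
  (forall x, simplex B x -> `|q x| <= L) ->
  (forall x y, simplex B x -> simplex B y -> `|q x - q y| <= L * `|x - y|) ->
  (forall x, simplex B x -> simplex A x -> q x = 0) ->
  exists2 C, 0 <= C & forall x, simplex B x -> `|q x| <= C * exterior_gap A x.
Proof.
move=> d0 L0 qL qlip q0; have [c c0 cP] := gap_ge d0.
pose K := \sum_i `|B i|; have K0 : 0 <= K by exact: sumr_ge0.
exists ((L * K + L) / c); first by rewrite divr_ge0 ?(ltW c0)// addr_ge0// mulr_ge0.
move=> x Bx; have bx := (simplexP x aiB).1 Bx.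
apply: (@le_trans _ _ ((L * K + L) / c * gap x)); last first.
  apply: ler_wpM2l; last exact: gap_le.
  by rewrite divr_ge0 ?(ltW c0)// addr_ge0// mulr_ge0.
pose s := \sum_(i | ~~ IB i) bary B i x.
have s0 : 0 <= s by exact: sumr_ge0.
have b_le i : ~~ IB i -> bary B i x <= s.
  by move=> nI; rewrite /s (bigD1 i)//= lerDl sumr_ge0.
have gap0 : 0 <= gap x by apply: sumr_ge0 => j _; rewrite le_max lexx.
have [sE|sneq0] := eqVneq s 0.
  rewrite q0// ?normr0 ?mulr_ge0 ?invr_ge0 ?(ltW c0)// ?addr_ge0 ?mulr_ge0//.
  apply: confA => // i nI; apply: le_anti; rewrite bx andbT -sE.
  exact: b_le.
have sgt0 : 0 < s by rewrite lt_neqAle eq_sym sneq0.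
have sc : s * c <= gap x.
  pose a i := if IB i then 0 else bary B i x / s.
  have a0 i : 0 <= a i by rewrite /a; case: ifP => // _; rewrite divr_ge0.
  have a1 : \sum_i a i = 1.
    rewrite (bigID IB)/= big1 ?add0r => [|i Ii]; last by rewrite /a Ii.
    rewrite (eq_bigr (fun i => bary B i x / s)) => [|i nI]; last by rewrite /a (negbTE nI).
    by rewrite -mulr_suml divff.
  pose w := \sum_i a i *: B i.
  have Fw : far w.
    split; first exact: simplex_comb.
    by move=> i Ii; rewrite (baryE aiB a1 (erefl w)) /a Ii.
  apply: (@le_trans _ _ (s * gap w)); first by rewrite ler_wpM2l ?cP.
  rewrite /gap mulr_sumr; apply: ler_sum => j nj.
  have -> : bary A j x = s * bary A j w.
    rewrite {1}(bary_comb x aiB) bary_affine ?bary_sum1// bary_affine// mulr_sumr.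
    apply: eq_bigr => i _; rewrite /a mulrA; case: ifPn => Ii.
      have /existsP[k /eqP kE] := Ii.
      rewrite -kE (bary_vertex _ _ aiA) (_ : (j == k) = false) ?mulr0 ?mul0r//.
      apply/negbTE; apply: contra nj => /eqP ->.
      by apply/existsP; exists i; apply/eqP.
    by rewrite mulrCA divff// mulr1.
  by rewrite -mulrN -[X in Num.max X (s * _)](mulr0 s) maxr_pMr.
suff qs : `|q x| <= (L * K + L) * s.
  apply: (le_trans qs); rewrite -mulrA ler_wpM2l ?addr_ge0 ?mulr_ge0//.
  by rewrite ler_pdivlMl// mulrC.
have [noI|] := boolP [forall i, ~~ IB i].
  have s1 : s = 1.
    by rewrite /s -(bary_sum1 B x); apply: eq_bigl => i; rewrite (forallP noI).
  by rewrite s1 mulr1 (le_trans (qL _ Bx))// lerDr mulr_ge0.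
rewrite negb_forall => /existsP[i0]; rewrite negbK => Ii0.
(* [z] is [x] with the whole weight [s] moved to a shared vertex. *)
pose g i := (if IB i then bary B i x else 0) + (i == i0)%:R * s.
have g0 i : 0 <= g i.
  by rewrite addr_ge0 ?mulr_ge0 ?ler0n//; case: ifP.
have g1 : \sum_i g i = 1.
  have i01 : \sum_i (i == i0)%:R = 1 :> R.
    by rewrite (bigD1 i0)//= eqxx big1 ?addr0// => i /negbTE ->.
  rewrite big_split/= -big_mkcond/= -mulr_suml i01 mul1r.
  by rewrite -(bary_sum1 B x) [in RHS](bigID IB).
pose z := \sum_i g i *: B i.
have Bz : simplex B z by exact: simplex_comb.
have qz : q z = 0.
  apply: q0 => //; apply: confA => // i nI; rewrite (baryE aiB g1 (erefl z)) /g.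
  rewrite (negbTE nI) add0r (_ : i == i0 = false) ?mul0r//.
  by apply: contraNF nI => /eqP ->.
have xz : `|x - z| <= K * s.
  rewrite {1}(bary_comb x aiB) -sumrB (le_trans (ler_norm_sum _ _ _))// mulr_suml.
  apply: ler_sum => i _; rewrite -scalerBl normrZ mulrC ler_wpM2l//.
  rewrite /g; case: ifPn => Ii.
    rewrite opprD addrA subrr add0r normrN.
    by case: (i == i0); rewrite ?mul1r ?mul0r ?normr0 ?ger0_norm.
  rewrite (_ : i == i0 = false) ?mul0r ?addr0 ?subr0 ?ger0_norm ?b_le//.
  by apply: contraNF Ii => /eqP ->.
rewrite -[q x]subr0 -qz (le_trans (qlip _ _ Bx Bz))// mulrDl.
apply: (@le_trans _ _ (L * (K * s))); first by rewrite ler_wpM2l.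
by rewrite mulrA lerDl mulr_ge0.
Qed.

End conforming_pair.
End simplex_geometry.

(** * The soft maximum *)

Section softmax.
Context {R : realType} {K : finType}.
Implicit Types (e : R) (h : K -> R).

(** A smooth version of the maximum of the [h k]; it exceeds it by at most
    [e * ln #|K|]. *)
Definition lse e h : R := e * ln (\sum_k expR (h k / e)).

(** The partial derivatives of [lse]: the weights of a convex combination. *)
Definition softmax e h k : R := expR (h k / e) / \sum_j expR (h j / e).

Lemma sum_expR_gt0 (k0 : K) h : 0 < \sum_k expR (h k).
Proof.
by rewrite (bigD1 k0)//= ltr_pwDl ?expR_gt0// sumr_ge0// => k _; exact: expR_ge0.
Qed.

Lemma softmax_ge0 e h k : 0 <= softmax e h k.
Proof. by rewrite divr_ge0 ?expR_ge0 ?sumr_ge0// => j _; exact: expR_ge0. Qed.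

Lemma softmax_sum1 e h (k0 : K) : \sum_k softmax e h k = 1.
Proof. by rewrite -mulr_suml divff// gt_eqF// sum_expR_gt0. Qed.

Lemma lse_ge e h k : 0 < e -> h k <= lse e h.
Proof.
move=> e0; rewrite /lse mulrC -ler_pdivrMr// -[X in X <= _]expRK.
rewrite ler_ln ?posrE ?expR_gt0 ?(sum_expR_gt0 k)//.
by rewrite (bigD1 k)//= lerDl sumr_ge0// => j _; exact: expR_ge0.
Qed.

Lemma lse_le e h (M : R) (k0 : K) : 0 < e -> (forall k, h k <= M) ->
  lse e h <= M + e * ln #|K|%:R.
Proof.
move=> e0 hM; have K0 : 0 < #|K|%:R :> R by rewrite ltr0n; apply/card_gt0P; exists k0.
apply: (@le_trans _ _ (e * ln (#|K|%:R * expR (M / e)))).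
  rewrite ler_wpM2l ?(ltW e0)// ler_ln ?posrE ?(sum_expR_gt0 k0)//; last first.
    by rewrite mulr_gt0// expR_gt0.
  rewrite -sum1_card natr_sum mulr_suml.
  by apply: ler_sum => k _; rewrite mul1r ler_expR ler_pdivrMr// divfK// gt_eqF.
rewrite lnM ?posrE ?expR_gt0// expRK mulrDr addrC lerD2r mulrCA divff ?mulr1//.
by rewrite gt_eqF.
Qed.

Lemma softmax_mean_le e h (a : K -> R) (M : R) (k0 : K) :
  (forall k, `|a k| <= M) -> `|\sum_k softmax e h k * a k| <= M.
Proof.
move=> aM; apply: (le_trans (ler_norm_sum _ _ _)).
apply: (@le_trans _ _ (\sum_k softmax e h k * M)).
  by apply: ler_sum => k _; rewrite normrM ger0_norm ?softmax_ge0// ler_wpM2l ?softmax_ge0.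
by rewrite -mulr_suml (softmax_sum1 _ _ k0) mul1r.
Qed.

Lemma softmax_le e h (k k0 : K) : softmax e h k <= expR ((h k - h k0) / e).
Proof.
rewrite mulrBl expRB ler_wpM2l ?expR_ge0// lef_pV2 ?posrE ?expR_gt0 ?(sum_expR_gt0 k0)//.
by rewrite (bigD1 k0)//= lerDl sumr_ge0// => j _; exact: expR_ge0.
Qed.

Let eps (n : nat) : R := n.+1%:R^-1.

(** The weight of a competitor that loses by a margin [c] is at most
    [expR (- c / eps n)], which is at most [eps n / c]. *)
Lemma softmax_cvg0 (h : nat -> K -> R) (H : K -> R) k k0 :
  (forall j, h ^~ j @ \oo --> H j) -> H k < H k0 ->
  softmax (eps n) (h n) k @[n --> \oo] --> 0.
Proof.
move=> hH Hk; pose c := (H k0 - H k) / 2.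
have c0 : 0 < c by rewrite divr_gt0// subr_gt0.
have eps0 : eps n / c @[n --> \oo] --> 0.
  by rewrite -[X in _ --> X](mul0r c^-1); exact: (cvgM (@cvg_harmonic R) (cvg_cst c^-1)).
apply: (squeeze_cvgr _ (cvg_cst 0) eps0).
have : \forall n \near \oo, h n k - h n k0 < - c.
  apply: (cvgr_lt (H k - H k0)); first by apply: cvgB; exact: hH.
  by rewrite /c; lra.
apply: filterS => n hn; rewrite softmax_ge0/= (le_trans (softmax_le _ _ _ k0))//.
have e0 : 0 < eps n by rewrite invr_gt0.
apply: (@le_trans _ _ (expR (- (c / eps n)))).
  by rewrite ler_expR -mulNr ler_pM2r ?invr_gt0// ltW.
rewrite expRN -[X in _ <= X]invf_div lef_pV2 ?posrE ?expR_gt0 ?divr_gt0 ?subr_gt0//.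
by apply: le_trans (expR_ge1Dx _); rewrite lerDr.
Qed.

(** When one competitor is strictly the largest in the limit, the weights
    concentrate on it; the boundedness of the averaged family [a] controls the
    other terms. *)
Lemma softmax_mean_cvg (h a : nat -> K -> R) (H : K -> R) (l M : R) k0 :
  (forall j, h ^~ j @ \oo --> H j) -> (forall k, k != k0 -> H k < H k0) ->
  (forall n k, `|a n k| <= M) -> a ^~ k0 @ \oo --> l ->
  \sum_k softmax (eps n) (h n) k * a n k @[n --> \oo] --> l.
Proof.
move=> hH Hk aM al.
have -> : (fun n => \sum_k softmax (eps n) (h n) k * a n k) =
    (fun n => a n k0 + \sum_(k | k != k0) softmax (eps n) (h n) k * (a n k - a n k0)).
  apply/funext => n; rewrite (bigD1 k0)//=.
  have -> : softmax (eps n) (h n) k0 =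
      1 - \sum_(k | k != k0) softmax (eps n) (h n) k.
    by rewrite -(softmax_sum1 (eps n) (h n) k0) (bigD1 k0)//= addrK.
  rewrite mulrBl mul1r -addrA; congr (_ + _).
  rewrite mulr_suml addrC -sumrB; apply: eq_bigr => k _; ring.
rewrite -[X in _ --> X]addr0; apply: cvgD => //.
rewrite -[X in _ --> X](@big1 R 0 +%R _ (index_enum K) (fun k => k != k0) (fun=> 0))//.
apply: cvg_sumr => k kk0.
apply/cvgr0Pnorm_le => d d0.
have /cvgr0Pnorm_le := softmax_cvg0 hH (Hk _ kk0).
have D0 : 0 < 2 * `|M| + 1 by rewrite ltr_wpDl// mulr_ge0.
move=> /(_ (d / (2 * `|M| + 1))); rewrite divr_gt0// => /(_ isT).
apply: filterS => n hn; rewrite normrM.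
apply: (@le_trans _ _ (d / (2 * `|M| + 1) * (2 * `|M| + 1))); last first.
  by rewrite divfK// gt_eqF.
apply: ler_pM => //; apply: (le_trans (ler_normB _ _)).
have := aM n k; have := aM n k0; have := ler_norm M; lra.
Qed.

End softmax.

Section lse_C1.
Context {R : realType} {d : nat} {K : finType}.

Lemma C1_lse (e : R) (h : K -> 'rV[R]_d -> R) dh (k0 : K) : e != 0 ->
  (forall k, C1 (h k) (dh k)) ->
  C1 (fun x => lse e (fun k => h k x))
     (fun v x => \sum_k softmax e (fun k => h k x) k * dh k v x).
Proof.
move=> e0 Ch.
have Cexp k : C1 (fun x => expR (h k x / e)) (fun v x => expR (h k x / e) * (dh k v x / e)).
  have Cd : C1 (fun x => h k x / e) (fun v x => dh k v x / e).
    apply: (C1_ext (C1M (Ch k) (C1_cst e^-1))) => // v x.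
    by rewrite mulr0 add0r mulrC.
  apply: (C1_comp (phi := expR) (dphi := expR) Cd) => x.
  exact: continuous_expR.
have Csum := C1_sum (index_enum K) Cexp.
have S0 x : 0 < \sum_k expR (h k x / e) by exact: sum_expR_gt0.
have Dln x := is_derive1_ln (S0 x).
have cV x : {for \sum_k expR (h k x / e), continuous (fun y : R => y^-1)}.
  by apply: inv_continuous; rewrite gt_eqF.
have Cln := C1_comp (phi := @ln R) Csum Dln cV.
apply: (C1_ext (C1M (C1_cst e) Cln)) => // v x.
rewrite mulr0 addr0 mulrA mulr_sumr; apply: eq_bigr => k _.
rewrite /softmax; field.
by rewrite e0 gt_eqF.
Qed.

End lse_C1.

(** * Smooth approximation of continuous piecewise polynomials *)

Section smoothing.
Context {R : realType} {d : nat}.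
Variables (Omega : set 'rV[R]_d) (T : @mesh R d).
Hypotheses (d_gt0 : (0 < d)%N) (T_mesh : conforming_mesh Omega T).
Notation K := 'I_(mesh_size T).
Notation vtx := (@mesh_vertex R d T).

Let ai k : affinely_independent (vtx k) := mesh_nondegenerate T_mesh k.

Lemma elementP k x : element k x <-> forall i, 0 <= bary (vtx k) i x.
Proof. exact: simplexP. Qed.

Lemma interior_elementP k x :
  interior (element k) x <-> forall i, 0 < bary (vtx k) i x.
Proof. exact: interior_simplexP. Qed.

(** If an interior point of [k] lay in [l], conformity would place it on a face
    of [k] spanned by common vertices; having positive coordinates it forces every
    vertex of [k] to be common, so that [k] would be contained in [l]. *)
Lemma interior_element_other (k l : K) x :
  interior (element k) x -> element l x -> k = l.
Proof.
move=> ikx lx; apply/eqP; apply: contrapT => /negP kl.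
have kb := (interior_elementP k x).1 ikx.
have : face (vtx k) [set i | exists j, vtx l j = vtx k i] x.
  by rewrite -(mesh_conforming T_mesh); split=> //; exact: interior_subset.
move=> /(faceP _ _ (ai k))[_ zero].
have all_common i : exists j, vtx l j = vtx k i.
  by apply: contrapT => nI; have := kb i; rewrite zero ?ltxx.
have kl_sub : element k `<=` element l.
  move=> y ky; suff [] : (element k `&` element l) y by [].
  rewrite (mesh_conforming T_mesh); apply/(faceP _ _ (ai k)).
  by split=> [|i []//]; apply/elementP.
have : (interior (element k) `&` interior (element l)) x.
  by split=> //; exact: interiorS ikx.
by rewrite (mesh_nonoverlapping T_mesh kl).
Qed.

Lemma closure_mesh_norm_le : exists M : R, forall x, closure Omega x -> `|x| <= M.
Proof.
exists (\sum_(k : K) \sum_i `|vtx k i|) => x; rewrite (mesh_cover T_mesh) => -[k _ kx].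
rewrite (bigD1 k)//= (le_trans (simplex_norm_le (ai k) kx))// lerDl.
by rewrite sumr_ge0// => l _; rewrite sumr_ge0.
Qed.

Variables (g : 'rV[R]_d -> R) (p : K -> mpoly.mpoly d R).
Hypothesis gp : forall k x, element k x -> g x = pev (p k) x.

Let piece_gap (k l : K) : exists C : R, 0 <= C /\ forall x, element k x ->
  `|pev (p l) x - pev (p k) x| <= C * exterior_gap (vtx l) x.
Proof.
pose M := \sum_i `|vtx k i|.
have [L1 [L10 bd1 lip1]] := pev_bounded_lipschitz (p l) M.
have [L2 [L20 bd2 lip2]] := pev_bounded_lipschitz (p k) M.
have kM x : simplex (vtx k) x -> `|x| <= M by exact: simplex_norm_le.
have [||||C C0 CP] := @vanishing_le_gap _ _ (vtx l) (vtx k) (ai l) (ai k)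
    (mesh_conforming T_mesh k l) (fun x => pev (p l) x - pev (p k) x) (L1 + L2) d_gt0.
- exact: addr_ge0.
- move=> x kx; apply: (le_trans (ler_normB _ _)).
  by apply: lerD; [apply: bd1|apply: bd2]; exact: kM.
- move=> x y kx ky.
  rewrite (_ : _ - _ = (pev (p l) x - pev (p l) y) - (pev (p k) x - pev (p k) y)); last by ring.
  rewrite (le_trans (ler_normB _ _))// mulrDl.
  by apply: lerD; [apply: lip1|apply: lip2]; exact: kM.
- by move=> x kx lx; rewrite -(gp kx) -(gp lx) subrr.
by exists C; split.
Qed.

(* The constant is one more than the sum of the constants of all pairs; the
   extra one makes the inequality strict off the element [l], which decides the
   maximum at interior points. *)
Let slope : exists C : R, 0 <= C /\ forall k l x, element k x -> 
  pev (p l) x - C * exterior_gap (vtx l) x <= pev (p k) x /\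
  (0 < exterior_gap (vtx l) x ->
   pev (p l) x - C * exterior_gap (vtx l) x < pev (p k) x).
Proof.
pose c k l := sval (cid (piece_gap k l)).
have c0 k l : 0 <= c k l := (svalP (cid (piece_gap k l))).1.
have cP k l x : element k x -> 
    `|pev (p l) x - pev (p k) x| <= c k l * exterior_gap (vtx l) x.
  exact: (svalP (cid (piece_gap k l))).2.
exists (1 + \sum_k \sum_l c k l).
have S0 : 0 <= \sum_k \sum_l c k l by rewrite !sumr_ge0// => k _; rewrite sumr_ge0.
split=> [|k l x kx]; first by rewrite addr_ge0.
have cS : c k l <= \sum_k \sum_l c k l.
  rewrite (bigD1 k)//= (bigD1 l)//= -addrA lerDl addr_ge0//.
    by rewrite sumr_ge0.
  by rewrite !sumr_ge0// => k' _; rewrite sumr_ge0.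
have := cP k l x kx; move: (\sum_k _) cS S0 => S cS S0.
have gap0 : 0 <= exterior_gap (vtx l) x.
  by apply: sumr_ge0 => i _; rewrite le_max lexx.
have := ler_norm (pev (p l) x - pev (p k) x).
move: (exterior_gap _ _) gap0 => G G0 h1 h2.
have h3 : c k l * G <= S * G by rewrite ler_wpM2r.
by split; nra.
Qed.

Let eps (n : nat) : R := n.+1%:R^-1.
Let eps_gt0 n : 0 < eps n. Proof. by rewrite invr_gt0. Qed.
Let eps_neq0 n : eps n != 0. Proof. exact: lt0r_neq0. Qed.

(* The two competitors whose maximum is the negative part of a coordinate. *)
Let part k i (x : 'rV[R]_d) (b : bool) : R := if b then 0 else - bary (vtx k) i x.

Let dpart k i (v x : 'rV[R]_d) (b : bool) : R :=
  if b then 0 else - dotv v (bary_grad (vtx k) i).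

Let C1_part k i b : C1 (fun x => part k i x b) (fun v x => dpart k i v x b).
Proof.
case: b; first exact: C1_cst.
apply: (C1_ext (C1M (C1_cst (-1)) (C1_bary (vtx k) i))) => *.
  by rewrite mulN1r.
by rewrite mulr0 addr0 mulN1r.
Qed.

Let smooth_gap n k x := \sum_i lse (eps n) (part k i x).

Let dsmooth_gap n k v x :=
  \sum_i \sum_b softmax (eps n) (part k i x) b * dpart k i v x b.

Let C1_smooth_gap n k : C1 (smooth_gap n k) (dsmooth_gap n k).
Proof.
apply: C1_sum => i.
exact: (C1_lse true (eps_neq0 n) (C1_part k i)).
Qed.

Let smooth_gap_bounds n k x : exterior_gap (vtx k) x <= smooth_gap n k x <=
  exterior_gap (vtx k) x + d.+1%:R * (eps n * ln 2).
Proof.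
apply/andP; split.
  apply: ler_sum => i _; rewrite ge_max.
  by have := lse_ge (part k i x) true (eps_gt0 n);
     have := lse_ge (part k i x) false (eps_gt0 n) => /= -> ->.
rewrite -[d.+1 in X in _ + X]card_ord -sum1_card natr_sum mulr_suml -big_split/=.
apply: ler_sum => i _; rewrite mul1r.
have := @lse_le _ _ (eps n) (part k i x) (Num.max 0 (- bary (vtx k) i x)) true (eps_gt0 n).
by rewrite card_bool; apply=> -[]; rewrite /= le_max lexx ?orbT.
Qed.

Let C := sval (cid slope).
Let C_ge0 : 0 <= C := (svalP (cid slope)).1.
Let cone_le k l x : element k x ->
  pev (p l) x - C * exterior_gap (vtx l) x <= pev (p k) x.
Proof. by move=> /((svalP (cid slope)).2 k l x)[]. Qed.
Let cone_lt k l x : element k x -> 0 < exterior_gap (vtx l) x ->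
  pev (p l) x - C * exterior_gap (vtx l) x < pev (p k) x.
Proof. by move=> /((svalP (cid slope)).2 k l x)[]. Qed.

(* On the closure of the domain [g] is the maximum of these functions. *)
Let cone (k : K) x := pev (p k) x - C * exterior_gap (vtx k) x.

Let smooth_cone n (k : K) x := pev (p k) x - C * smooth_gap n k x.

Let dsmooth_cone n (k : K) (v x : 'rV[R]_d) : R :=
  \sum_(i < d) v ord0 i * pev (mpoly.mderiv i (p k)) x - C * dsmooth_gap n k v x.

Let C1_smooth_cone n k : C1 (smooth_cone n k) (dsmooth_cone n k).
Proof.
apply: (C1_ext (C1D (C1_pev (p k)) (C1M (C1_cst (- C)) (C1_smooth_gap n k)))).
  by move=> x; rewrite mulNr.
by move=> v x; rewrite mulr0 addr0 mulNr.
Qed.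

Let gap_elt (k : K) x : element k x -> exterior_gap (vtx k) x = 0.
Proof.
move=> /elementP kx; apply: big1 => i _; apply/max_idPl.
by rewrite oppr_le0.
Qed.

Let cone_elt (k l : K) x : element k x -> cone l x <= g x.
Proof. by move=> kx; rewrite (gp kx); exact: cone_le. Qed.

Let cone_self (k : K) x : element k x -> cone k x = g x.
Proof. by move=> kx; rewrite /cone gap_elt// mulr0 subr0 -gp. Qed.

Let smooth_cone_bounds n k x :
  cone k x - C * (d.+1%:R * (eps n * ln 2)) <= smooth_cone n k x <= cone k x.
Proof.
have /andP[h1 h2] := smooth_gap_bounds n k x.
rewrite /cone /smooth_cone -addrA -opprD -mulrDr !lerD2l !lerN2.
by apply/andP; split; apply: ler_wpM2l.
Qed.

Let approx n x := lse (eps n) (fun k => smooth_cone n k x).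

Let dapprox n v x :=
  \sum_k softmax (eps n) (fun k => smooth_cone n k x) k * dsmooth_cone n k v x.

Let approx_bounds n (k : K) x : element k x ->
  g x - eps n * (C * (d.+1%:R * ln 2)) <= approx n x <= g x + eps n * ln (mesh_size T)%:R.
Proof.
move=> kx; apply/andP; split.
  apply: le_trans (lse_ge (fun k => smooth_cone n k x) k (eps_gt0 n)).
  apply: le_trans (andP (smooth_cone_bounds n k x)).1.
  rewrite (cone_self kx) lerD2l lerN2 le_eqVlt; apply/orP; left; apply/eqP; ring.
have := @lse_le _ _ (eps n) (fun k => smooth_cone n k x) (g x) k (eps_gt0 n).
rewrite card_ord; apply=> l; apply: le_trans (cone_elt l kx).
exact: (andP (smooth_cone_bounds n l x)).2.
Qed.

Let eps_cvg0 c : eps n * c @[n --> \oo] --> (0 : R).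
Proof.
rewrite -[X in _ --> X](mul0r c).
exact: (cvgM (@cvg_harmonic R) (cvg_cst c)).
Qed.

Let eps_le1 n : eps n <= 1.
Proof. by rewrite invf_le1// ler1n. Qed.

Let approx_cvg x : closure Omega x -> approx n x @[n --> \oo] --> g x.
Proof.
rewrite (mesh_cover T_mesh) => -[k _ kx].
have l1 : g x - eps n * (C * (d.+1%:R * ln 2)) @[n --> \oo] --> g x.
  rewrite -[X in _ --> X]subr0; apply: cvgB; first exact: cvg_cst.
  exact: eps_cvg0.
have l2 : g x + eps n * ln (mesh_size T)%:R @[n --> \oo] --> g x.
  rewrite -[X in _ --> X]addr0; apply: cvgD; first exact: cvg_cst.
  exact: eps_cvg0.
apply: (squeeze_cvgr _ l1 l2); apply: nearW => n; exact: approx_bounds kx.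
Qed.

Let approx_bounded : exists M, forall n x, closure Omega x -> `|approx n x| <= M.
Proof.
have [M MP] := closure_mesh_norm_le.
have bd k := cid (pev_bounded_lipschitz (p k) M).
pose L := \sum_k sval (bd k).
pose c1 := C * (d.+1%:R * ln 2); pose c2 := ln (mesh_size T)%:R : R.
exists (L + (`|c1| + `|c2|)) => n x Ox.
have := Ox; rewrite (mesh_cover T_mesh) => -[k _ kx].
have gL : `|g x| <= L.
  have [_ b _] := svalP (bd k).
  rewrite (gp kx) (le_trans (b _ (MP _ Ox)))// /L (bigD1 k)//= lerDl.
  by rewrite sumr_ge0// => l _; have [] := svalP (bd l).
have := approx_bounds n kx; rewrite -/c1 -/c2 => /andP[h1 h2].
have e1 c : `|eps n * c| <= `|c|.
  by rewrite normrM ger0_norm ?ler_piMl ?(ltW (eps_gt0 n)).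
have := e1 c1; have := e1 c2; move: h1 h2 gL; rewrite !ler_norml.
have := normr_ge0 c1; have := normr_ge0 c2; lra.
Qed.

Let dapprox_bounded v : exists M, forall n x, closure Omega x -> `|dapprox n v x| <= M.
Proof.
have [M MP] := closure_mesh_norm_le.
have bd k i := cid (pev_bounded_lipschitz (mpoly.mderiv i (p k)) M).
pose L k := \sum_(i < d) `|v ord0 i| * sval (bd k i) +
  C * \sum_i `|dotv v (bary_grad (vtx k) i)|.
have L0 k : 0 <= L k.
  apply: addr_ge0; last by rewrite mulr_ge0// sumr_ge0.
  by apply: sumr_ge0 => i _; rewrite mulr_ge0//; have [] := svalP (bd k i).
have cone_bound n k x : closure Omega x -> `|dsmooth_cone n k v x| <= L k.
  move=> Ox; apply: (le_trans (ler_normB _ _)); apply: lerD.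
    apply: (le_trans (ler_norm_sum _ _ _)); apply: ler_sum => i _.
    by rewrite normrM ler_wpM2l//; have [_ b _] := svalP (bd k i); exact/b/MP.
  rewrite normrM ger0_norm// ler_wpM2l// (le_trans (ler_norm_sum _ _ _))//.
  apply: ler_sum => i _; apply: (softmax_mean_le _ _ true) => -[] /=.
    by rewrite normr0.
  by rewrite normrN.
exists (\sum_k L k) => n x Ox.
have := Ox; rewrite (mesh_cover T_mesh) => -[k0 _ _].
apply: (softmax_mean_le _ _ k0) => k; apply: (le_trans (cone_bound n k x Ox)).
by rewrite (bigD1 k)//= lerDl sumr_ge0.
Qed.

Let dapprox_cvg (k : K) x v : interior (element k) x ->
  dapprox n v x @[n --> \oo] -->
  \sum_(i < d) v ord0 i * pev (mpoly.mderiv i (p k)) x.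
Proof.
move=> ikx; have kx := interior_subset ikx.
have Ox : closure Omega x by rewrite (mesh_cover T_mesh); exists k.
have kb := (interior_elementP k x).1 ikx.
have [M MP] := dapprox_bounded v.
pose Mc := \sum_k `|\sum_(i < d) v ord0 i * pev (mpoly.mderiv i (p k)) x|
   + \sum_k C * \sum_i `|dotv v (bary_grad (vtx k) i)|.
apply: (@softmax_mean_cvg _ _ _ (fun n k => dsmooth_cone n k v x) (cone ^~ x) _ Mc k).
- move=> j.
  have l1 : cone j x - C * (d.+1%:R * (eps n * ln 2)) @[n --> \oo] --> cone j x.
    rewrite -[X in _ --> X]subr0; apply: cvgB; first exact: cvg_cst.
    rewrite (_ : (fun n => _) = fun n => eps n * (C * (d.+1%:R * ln 2))).
      exact: eps_cvg0.
    by apply/funext => n; ring.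
  apply: (squeeze_cvgr _ l1 (cvg_cst (cone j x))).
  by apply: nearW => n; exact: smooth_cone_bounds.
- move=> l lk; rewrite (cone_self kx) (gp kx).
  apply: cone_lt => //.
  rewrite lt_neqAle sumr_ge0 ?andbT => [|i _]; last by rewrite le_max lexx.
  apply: contra lk => /eqP/esym/eqP; rewrite psumr_eq0 => [/allP/= h|i _]; last first.
    by rewrite le_max lexx.
  rewrite eq_sym; apply/eqP; apply: interior_element_other ikx _.
  apply/elementP => i; have /eqP m0 := h i (mem_index_enum _).
  have : - bary (vtx l) i x <= Num.max 0 (- bary (vtx l) i x).
    by rewrite le_max lexx orbT.
  by rewrite m0 oppr_le0.
- move=> n j; apply: (le_trans (ler_normB _ _)); apply: lerD.
    by rewrite (bigD1 j)//= lerDl sumr_ge0.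
  rewrite (bigD1 j)//=; apply: ler_wpDr.
    by rewrite sumr_ge0// => l _; rewrite mulr_ge0// sumr_ge0.
  rewrite normrM ger0_norm// ler_wpM2l// (le_trans (ler_norm_sum _ _ _))//.
  apply: ler_sum => i _; apply: (softmax_mean_le _ _ true) => -[] /=.
    by rewrite normr0.
  by rewrite normrN.
- rewrite -[X in _ --> X]subr0; apply: cvgB; first exact: cvg_cst.
  rewrite -(mulr0 C); apply: cvgM; first exact: cvg_cst.
  rewrite -[X in _ --> X](@big1 R 0 +%R _ (index_enum 'I_d.+1) xpredT (fun=> 0))//.
  apply: cvg_sumr => i _.
  apply: (@softmax_mean_cvg _ _ (fun _ => part k i x) (fun _ => dpart k i v x)
    (part k i x) 0 `|dotv v (bary_grad (vtx k) i)| true).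
  + by move=> j; exact: cvg_cst.
  + by case=> //= _; rewrite oppr_lt0.
  + by move=> n [] /=; rewrite ?normr0 ?normrN.
  + exact: cvg_cst.
Qed.

(** The point of this approximation is the last two items: although [g] has
    kinks on the faces of the mesh, the approximations are C^1 on the whole
    space with gradients bounded uniformly up to these faces. *)
Lemma lagrange_smoothing : exists G dG, [/\
  forall n : nat, C1 (G n) (dG n),
  forall x, closure Omega x -> G n x @[n --> \oo] --> g x,
  exists M, forall n x, closure Omega x -> `|G n x| <= M,
  forall v, exists M, forall n x, closure Omega x -> `|dG n v x| <= M &
  forall (k : K) x v, interior (element k) x ->
    dG n v x @[n --> \oo] --> \sum_(i < d) v ord0 i * pev (mpoly.mderiv i (p k)) x].
Proof.
have [[k0 _]|K0] := pselect (exists k : K, True).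
  exists approx, dapprox; split.
  - by move=> n; exact: (C1_lse k0 (eps_neq0 n) (C1_smooth_cone n)).
  - by move=> x; exact: approx_cvg.
  - exact: approx_bounded.
  - exact: dapprox_bounded.
  - by move=> k x v; exact: dapprox_cvg.
have O0 x : ~ closure Omega x.
  by rewrite (mesh_cover T_mesh) => -[k _ _]; apply: K0; exists k.
exists (fun _ _ => 0), (fun _ _ _ => 0); split => //.
- by move=> n; exact: C1_cst.
- by move=> x /O0.
- by exists 0 => n x /O0.
- by move=> v; exists 0 => n x /O0.
- by move=> k; exfalso; apply: K0; exists k.
Qed.

End smoothing.

(** * Outer measures additive on separated sets *)

Section separating_function.
Context {R : realType} {T : Type} (mu : {outer_measure set T -> \bar R}).
Variable f : T -> R.
Hypothesis mu_separated : forall (A B : set T) r, 0 < r ->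
  (forall x y, A x -> B y -> r <= `|f x - f y|) -> (mu A + mu B <= mu (A `|` B))%E.

(* The part of [X] where [f] exceeds [a] is cut into shells; shells of the same
   parity are separated by a positive gap of [f], so that [mu] is additive on
   them. *)
Let shell (X : set T) a k : set T :=
  [set x | X x /\ a + k.+2%:R^-1 <= f x < a + k.+1%:R^-1].

Let stripes X a (b : bool) m : set T :=
  [set x | exists k, [/\ (k < m)%N, odd k = b & shell X a k x]].

Let stripesS X a m : (mu (stripes X a (odd m) m) + mu (shell X a m)
  <= mu (stripes X a (odd m) m.+1))%E.
Proof.
apply: (@le_trans _ _ (mu (stripes X a (odd m) m `|` shell X a m))); last first.
  apply: le_outer_measure => x [[k [km ok Sx]]|Sx].
    by exists k; split => //; exact: ltnW.
  by exists m; split.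
case: m => [|m].
  rewrite (_ : stripes _ _ _ _ = set0) ?outer_measure0 ?add0e ?set0U//.
  by apply/seteqP; split=> // x [k []].
apply: (@mu_separated _ _ (m.+1%:R^-1 - m.+2%:R^-1)).
  by rewrite subr_gt0 ltf_pV2 ?posrE// ltr_nat.
move=> x y [k [km ok [_ /andP[kx _]]]] [_ /andP[_ my]].
have {ok}km : (k < m)%N.
  move: km; rewrite ltnS leq_eqVlt => /predU1P[km|//].
  by move: ok; rewrite km /=; case: (odd m).
have : m.+1%:R^-1 <= k.+2%:R^-1 :> R by rewrite lef_pV2 ?posrE// ler_nat.
have := ler_norm (f x - f y).
move: kx my; move: m.+1%:R^-1 m.+2%:R^-1 k.+2%:R^-1 => p q s; lra.
Qed.

Let shells_le X a m : (\sum_(k < m) mu (shell X a k) <=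
  mu (stripes X a false m) + mu (stripes X a true m))%E.
Proof.
elim: m => [|m IH]; first by rewrite big_ord0 adde_ge0 ?outer_measure_ge0.
rewrite big_ord_recr/=; apply: (le_trans (leeD2r _ IH)).
have st b : (mu (stripes X a b m) <= mu (stripes X a b m.+1))%E.
  apply: le_outer_measure => x [k [km ok Sx]].
  by exists k; split => //; exact: ltnW.
have := stripesS X a m; case: (odd m) => h.
  by rewrite -addeA; apply: leeD.
by rewrite addeAC; apply: leeD.
Qed.

(** The sets [X `&` [set x | f x <= a]] and [X `&` [set x | a + n.+1%:R^-1 <= f x]]
    are separated, so [mu] is additive on them.  What is missing from [X] is
    covered by the shells of index at least [n], whose measures form the tail of
    a convergent series: the series is bounded by twice [mu X]. *)
Lemma separated_caratheodory a : mu.-caratheodory [set x | f x <= a].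
Proof.
apply: le_caratheodory_measurable => X.
have [->|Xfin] := eqVneq (mu X) +oo%E; first exact: leey.
have muX : (mu X < +oo)%E by rewrite ltey.
set C := [set x | _].
have sumR : (\sum_(0 <= k <oo) mu (shell X a k) < +oo)%E.
  apply: (@le_lt_trans _ _ (mu X + mu X)%E); last by rewrite lte_add_pinfty.
  apply: lime_le; first by apply: is_cvg_nneseries => *; exact: outer_measure_ge0.
  apply: nearW => m; rewrite big_mkord; apply: (le_trans (shells_le X a m)).
  by apply: leeD; apply: le_outer_measure => x [k [_ _ []]].
have tail := nneseries_tail_cvg sumR (fun k _ => outer_measure_ge0 mu _).
have key n : (mu (X `&` C) + mu (X `&` ~` C) <=
   mu X + \sum_(n <= k <oo) mu (shell X a k))%E.
  pose Xn := X `&` [set x | a + n.+1%:R^-1 <= f x].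
  have h1 : (mu (X `&` ~` C) <= mu Xn + \sum_(n <= k <oo) mu (shell X a k))%E.
    pose F k := if (n <= k)%N then shell X a k else set0.
    have -> : (\sum_(n <= k <oo) mu (shell X a k) = \sum_(k <oo) mu (F k))%E.
      rewrite eseries_cond eseries_mkcond; apply: eq_eseriesr => k _ /=.
      by rewrite /F; case: ifP => //; rewrite outer_measure0.
    apply: le_trans; last exact: leeD2l (outer_measure_sigma_subadditive mu F).
    apply: le_trans; last exact: outer_measureU2.
    apply: le_outer_measure => x [Xx] /= /negP; rewrite -ltNge => ax.
    have [nx|nx] := leP (a + n.+1%:R^-1) (f x); [by left|right].
    have fa0 : 0 < f x - a by rewrite subr_gt0.
    (* [k.+1] is the least index whose threshold does not exceed [f x]; the index
       [0] is impossible because [f x < a + n.+1%:R^-1 <= a + 1]. *)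
    have [k /andP[k1 k2]] : exists k, a + k.+2%:R^-1 <= f x < a + k.+1%:R^-1.
      pose P k := a + k.+1%:R^-1 <= f x.
      have exP : exists k, P k.
        exists (Num.truncn (f x - a)^-1); rewrite /P -lerBrDl invf_ple ?posrE//.
        exact/ltW/truncnS_gt.
      case: (ex_minnP exP) => -[|k] Pk mk.
        have := lt_le_trans nx (lerD (lexx a) _) => /(_ 1).
        move: Pk; rewrite /P invr1 => Pk; rewrite invf_le1 ?ltr0n// ler1n => /(_ isT).
        by rewrite ltNge Pk.
      exists k; apply/andP; split; first exact: Pk.
      by rewrite ltNge; apply: contraTN isT => /mk; rewrite ltnn.
    have nk : (n <= k)%N.
      rewrite leqNgt; apply/negP => kn.
      have : n.+1%:R^-1 <= k.+2%:R^-1 :> R by rewrite lef_pV2 ?posrE// ler_nat.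
      by move: nx k1; move: n.+1%:R^-1 k.+2%:R^-1 => p q; lra.
    by exists k => //; rewrite /F nk; split=> //; apply/andP.
  apply: (le_trans (leeD2l _ h1)); rewrite addeA; apply: leeD2r.
  apply: (@le_trans _ _ (mu ((X `&` C) `|` Xn))); last first.
    by apply: le_outer_measure => x [[]|[]].
  apply: (@mu_separated _ _ n.+1%:R^-1); first by rewrite invr_gt0.
  move=> x y [_ xC] [_ /= yX]; have := ler_norm (f y - f x); rewrite distrC.
  by move: xC yX; rewrite /C/=; move: n.+1%:R^-1 => p; lra.
have lim : (mu X + \sum_(N <= k <oo) mu (shell X a k) @[N --> \oo] --> mu X)%E.
  rewrite -[X in _ --> X]adde0; apply: cvgeD => //; last exact: cvg_cst.
  by rewrite fin_num_adde_defl.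
apply: (cvge_to_ge lim); exact: nearW.
Qed.

End separating_function.

(** * Borel sets and the Hausdorff measure *)

Section hausdorff_borel.
Context {R : realType} (n s : nat).
Implicit Types (A B : set 'rV[R]_n).

Lemma enorm_ge0 m (x : 'rV[R]_m) : 0 <= enorm x.
Proof. exact: sqrtr_ge0. Qed.

Lemma coord_le_enorm m (x : 'rV[R]_m) i : `|x ord0 i| <= enorm x.
Proof.
rewrite /enorm -sqrtr_sqr; apply: ler_wsqrtr; rewrite /dotv (bigD1 i)//= -expr2.
by rewrite lerDl sumr_ge0// => j _; rewrite -expr2 sqr_ge0.
Qed.

Lemma ediam_ge A x y : A x -> A y -> ((enorm (x - y))%:E <= ediam A)%E.
Proof. by move=> Ax Ay; apply: ereal_sup_ubound; exists (x, y). Qed.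

Lemma hausdorff_size_ge0 (delta : R) A : (0 <= hausdorff_size s delta A)%E.
Proof.
rewrite /hausdorff_size; case: ifPn => // /set0P[x Ax]; case: ifPn => // _.
rewrite lee_fin mulr_ge0 ?fine_ge0 ?exprn_ge0 ?divr_ge0 ?fine_ge0//.
by apply: le_trans (ediam_ge Ax Ax); rewrite lee_fin enorm_ge0.
Qed.

Lemma hausdorff_content_antitone (d1 d2 : R) A : d1 <= d2 ->
  (hausdorff_content s d2 A <= hausdorff_content s d1 A)%E.
Proof.
move=> d12; apply: le_ereal_inf_tmp => _ [F FA <-].
apply: (@le_trans _ _ (\sum_(k <oo) hausdorff_size s d2 (F k))%E).
  by apply: ereal_inf_lbound; exists F.
apply: lee_nneseries => [k _ _|k _]; first exact: hausdorff_size_ge0.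
rewrite /hausdorff_size; case: ifP => // _; case: ifPn => h1; case: ifPn => h2//.
  by rewrite leey.
by rewrite (le_trans h2) ?lee_fin in h1.
Qed.

(** A set of diameter at most [delta < r] cannot meet both [A] and [B], so every
    cover of the union by such sets splits into a cover of [A] and one of [B]. *)
Lemma hausdorff_content_separated (delta r : R) (j : 'I_n) A B : delta < r ->
  (forall x y, A x -> B y -> r <= `|x ord0 j - y ord0 j|) ->
  (hausdorff_content s delta A + hausdorff_content s delta B <=
   hausdorff_content s delta (A `|` B))%E.
Proof.
move=> dr sepAB; apply: le_ereal_inf_tmp => _ [F [_ FAB] <-].
pose trace C k := if F k `&` C == set0 then set0 else F k.
have traceE C : C `<=` A `|` B -> (hausdorff_content s delta C <=
    \sum_(k <oo) hausdorff_size s delta (trace C k))%E.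
  move=> CAB; apply: ereal_inf_lbound; exists (trace C) => //; split.
    by move=> k; exact: sub_sigma_algebra.
  move=> x Cx; have [k _ Fkx] := FAB _ (CAB _ Cx).
  by exists k => //; rewrite /trace; case: eqP => // /seteqP[/(_ x)]; case.
apply: (le_trans (leeD (traceE A _) (traceE B _))) => [x|x|]; [by left|by right|].
rewrite -nneseriesD; try by move=> *; exact: hausdorff_size_ge0.
have size0 : hausdorff_size s delta (set0 : set 'rV[R]_n) = 0%E.
  by rewrite /hausdorff_size eqxx.
apply: lee_nneseries => [k _ _|k _].
  by apply: adde_ge0; exact: hausdorff_size_ge0.
rewrite /trace; case: eqVneq => [|/set0P[x [Fx Ax]]].
  by move=> _; rewrite size0 add0e; case: ifP; rewrite ?size0 ?hausdorff_size_ge0.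
case: eqVneq => [|/set0P[y [Fy By]]]; first by rewrite size0 adde0.
rewrite {3}/hausdorff_size ifF; last first.
  by apply/negbTE/set0P; exists x.
rewrite ifF ?leey//; apply/negbTE; rewrite -ltNge.
apply: lt_le_trans (ediam_ge Fx Fy); rewrite lte_fin (lt_le_trans dr)//.
apply: (le_trans (sepAB _ _ Ax By)).
by have := coord_le_enorm (x - y) j; rewrite !mxE.
Qed.

(** Contents decrease with [delta], so the contents of [A] and [B] at any two
    scales may be compared at a common scale below [r]. *)
Lemma hausdorff_separated (r : R) (j : 'I_n) A B : 0 < r ->
  (forall x y, A x -> B y -> r <= `|x ord0 j - y ord0 j|) ->
  (hausdorff s A + hausdorff s B <= hausdorff s (A `|` B))%E.
Proof.
move=> r0 sepAB.
have [->|Hfin] := eqVneq (hausdorff s (A `|` B)) +oo%E; first exact: leey.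
have le_sup (d : R) (C : set ('rV[R]_n)) : 0 < d -> (hausdorff_content s d C <= hausdorff s C)%E.
  by move=> d0; apply: ereal_sup_ubound; exists d.
have le12 (d1 d2 : R) : 0 < d1 -> 0 < d2 ->
    (hausdorff_content s d1 A + hausdorff_content s d2 B <= hausdorff s (A `|` B))%E.
  move=> d10 d20; pose d := Num.min (r / 2) (Num.min d1 d2).
  have d0 : 0 < d by rewrite !lt_min d10 d20 divr_gt0.
  apply: (le_trans _ (le_sup d _ d0)).
  apply: (le_trans _ (@hausdorff_content_separated d r j A B _ sepAB)).
    by apply: leeD; apply: hausdorff_content_antitone; rewrite !ge_min lexx ?orbT.
  by rewrite gt_min; apply/orP; left; rewrite ltr_pdivrMr// ltr_pMr// ltr1n.
have ge0 (d : R) (C : set ('rV[R]_n)) : (0 <= hausdorff_content s d C)%E.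
  by apply: mu_ext_ge0; exact: hausdorff_size_ge0.
have fin (x y : \bar R) : (0 <= x -> 0 <= y -> y + x <= hausdorff s (A `|` B))%E ->
    (0 <= x)%E -> (0 <= y)%E -> x \is a fin_num.
  move=> h x0 y0; rewrite ge0_fin_numE//.
  apply: (@le_lt_trans _ _ (hausdorff s (A `|` B))); last by rewrite ltey.
  by apply: le_trans (h x0 y0); rewrite leeDr.
have A_le (d2 : R) : 0 < d2 ->
    (hausdorff s A + hausdorff_content s d2 B <= hausdorff s (A `|` B))%E.
  move=> d20.
  have f2 : hausdorff_content s d2 B \is a fin_num.
    by apply: (@fin _ (hausdorff_content s 1 A)) => // _ _; exact: le12.
  rewrite -leeBrDr//; apply: ge_ereal_sup => _ [d1 d10 <-].
  by rewrite leeBrDr//; exact: le12.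
have fA : hausdorff s A \is a fin_num.
  apply: (@fin _ (hausdorff_content s 1 B)) => //; last exact: outer_measure_ge0.
  by move=> _ _; rewrite addeC; exact: A_le.
rewrite addeC -leeBrDr//; apply: ge_ereal_sup => _ [d2 d20 <-].
by rewrite leeBrDr// addeC; exact: A_le.
Qed.

Notation surf := (caratheodory_type (@hausdorff_outer R n s)).

Lemma hausdorff_measurable_coord (j : 'I_n) :
  measurable_fun [set: surf] (fun x => (x : 'rV[R]_n) ord0 j).
Proof.
apply: (measurability _ (RGenOInfty.measurableE R)).
move=> _ [_ [a ->] <-]; rewrite setTI.
rewrite (_ : _ @^-1` _ = ~` [set x : surf | (x : 'rV[R]_n) ord0 j <= a]); last first.
  apply/seteqP; split=> x /=; rewrite in_itv/= andbT.
    by move=> ax /(lt_le_trans ax); rewrite ltxx.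
  by move=> /negP; rewrite -ltNge.
apply: measurableC; apply: separated_caratheodory => A B r r0 h.
exact: hausdorff_separated h.
Qed.

(** The identity from the Caratheodory structure to the Borel structure is
    measurable because its coordinates are. *)
Lemma hausdorff_borel (C : set 'rV[R]_n) :
  measurable (C : set (borelRn R n)) -> measurable (C : set surf).
Proof.
move=> mC; have := (measurable_fun_coordP (id : surf -> borelRn R n)).2
  hausdorff_measurable_coord.
by move=> /(_ measurableT _ mC); rewrite setTI.
Qed.

End hausdorff_borel.

(** * Interpolation of polynomials *)

Section interpolation.
Context {R : realType} {d : nat}.
Notation mpol := (mpoly.mpoly d R).

Lemma pevD (p q : mpol) x : pev (p + q) x = pev p x + pev q x.
Proof. exact: mpoly.mevalD. Qed.

Lemma pevZ c (p : mpol) x : pev (c *: p) x = c * pev p x.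
Proof. exact: mpoly.mevalZ. Qed.

Lemma pevM (p q : mpol) x : pev (p * q) x = pev p x * pev q x.
Proof. exact: mpoly.mevalM. Qed.

Lemma pev0 x : pev (0 : mpol) x = 0.
Proof. exact: mpoly.meval0. Qed.

Lemma pev_sum (I : Type) (r : seq I) (P : pred I) (f : I -> mpol) x :
  pev (\sum_(i <- r | P i) f i) x = \sum_(i <- r | P i) pev (f i) x.
Proof.
elim/big_rec2 : _ => [|i y1 y2 _ <-]; first exact: pev0.
exact: pevD.
Qed.

(** The span of a finite family, built one generator at a time to match the
    induction in the proof of [spanned_interpolation]. *)
Fixpoint spanned (s : seq mpol) (p : mpol) : Prop :=
  if s is b :: s' then exists c, spanned s' (p - c *: b) else p = 0.

Lemma spanned0 s : spanned s 0.
Proof. by elim: s => //= b s IH; exists 0; rewrite scale0r subr0. Qed.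

Lemma spannedD s p q : spanned s p -> spanned s q -> spanned s (p + q).
Proof.
elim: s p q => [|b s IH] p q /=; first by move=> -> ->; rewrite addr0.
move=> [c hc] [e he]; exists (c + e).
by rewrite scalerDl opprD addrACA; exact: IH.
Qed.

Lemma spannedZ s a p : spanned s p -> spanned s (a *: p).
Proof.
elim: s p => [|b s IH] p /=; first by move=> ->; rewrite scaler0.
by move=> [c hc]; exists (a * c); rewrite -scalerA -scalerBr; exact: IH.
Qed.

Lemma spanned_cons s b p : spanned s p -> spanned (b :: s) p.
Proof. by move=> sp; exists 0; rewrite scale0r subr0. Qed.

Lemma spanned_head s b : spanned (b :: s) b.
Proof. by exists 1; rewrite scale1r subrr; exact: spanned0. Qed.

Lemma spanned_sum (I : eqType) s (r : seq I) (f : I -> mpol) :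
  (forall i, i \in r -> spanned s (f i)) -> spanned s (\sum_(i <- r) f i).
Proof.
elim: r => [|i r IH] h; first by rewrite big_nil; exact: spanned0.
rewrite big_cons; apply: spannedD; first by apply: h; rewrite mem_head.
by apply: IH => j jr; apply: h; rewrite in_cons jr orbT.
Qed.

Lemma spanned_mem s b : b \in s -> spanned s b.
Proof.
elim: s => [//|c s IH]; rewrite in_cons => /predU1P[->|/IH].
  exact: spanned_head.
exact: spanned_cons.
Qed.

Lemma spanned_msize s k p : (forall b, b \in s -> (mpoly.msize b <= k)%N) ->
  spanned s p -> (mpoly.msize p <= k)%N.
Proof.
elim: s p => [|b s IH] p /= h; first by move=> ->; rewrite mpoly.msize0.
move=> [c /IH hc]; rewrite -(subrK (c *: b) p).
apply: (leq_trans (mpoly.msizeD_le _ _)); rewrite geq_max; apply/andP; split.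
  by apply: hc => b' b's; apply: h; rewrite in_cons b's orbT.
by apply: (leq_trans (mpoly.msizeZ_le _ _)); apply: h; rewrite mem_head.
Qed.

(** A new generator [b] is compared with its interpolant [I b].  Either they
    agree on [S] and the same nodes serve, or they differ at a point [y] of [S],
    which becomes a new node: the error [psi] of [b], normalized at [y], is its
    basis function, and the others are corrected to vanish at [y]. *)
Lemma spanned_interpolation (S : set 'rV[R]_d) s :
  exists nodes : seq ('rV[R]_d * mpol),
    (forall z, z \in nodes -> S z.1 /\ spanned s z.2) /\
    forall p, spanned s p -> forall x, S x ->
      pev p x = \sum_(z <- nodes) pev p z.1 * pev z.2 x.
Proof.
elim: s => [|b s [nodes [nS nI]]].
  by exists [::]; split=> // p -> x _; rewrite big_nil pev0.
pose I p : mpol := \sum_(z <- nodes) pev p z.1 *: z.2.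
have IE p x : pev (I p) x = \sum_(z <- nodes) pev p z.1 * pev z.2 x.
  by rewrite pev_sum; apply: eq_bigr => z _; rewrite pevZ.
have Isp p : spanned s (I p).
  by apply: spanned_sum => z zn; apply: spannedZ; exact: (nS z zn).2.
pose psi := b - I b.
have dec p : spanned (b :: s) p -> exists c, forall x, S x ->
    pev p x = pev (I p) x + c * pev psi x.
  move=> [c hc]; exists c => x Sx.
  rewrite /psi -scaleN1r pevD pevZ !IE.
  have := nI _ hc x Sx; rewrite -scaleNr pevD pevZ.
  have -> : \sum_(z <- nodes) pev (p + - c *: b) z.1 * pev z.2 x =
     \sum_(z <- nodes) pev p z.1 * pev z.2 x - c * \sum_(z <- nodes) pev b z.1 * pev z.2 x.
    rewrite mulr_sumr -sumrB; apply: eq_bigr => z _.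
    by rewrite pevD pevZ; ring.
  by move: (pev p x) (pev b x) (\sum_(z <- nodes) _) (\sum_(z <- nodes) _) => u w U W; nra.
have [psi0|] := pselect (forall x, S x -> pev psi x = 0).
  exists nodes; split=> [z zn|p pb x Sx].
    by have [? ?] := nS z zn; split=> //; exact: spanned_cons.
  by have [c ->//] := dec p pb; rewrite psi0// mulr0 addr0 IE.
move=> /existsNP[y /not_implyP[Sy /eqP psiy]].
pose corr (z : 'rV[R]_d * mpol) := (z.1, z.2 - (pev z.2 y / pev psi y) *: psi).
exists ((y, (pev psi y)^-1 *: psi) :: map corr nodes); split.
  have spsi : spanned (b :: s) psi.
    rewrite /psi -scaleN1r; apply: spannedD; first exact: spanned_head.
    by apply: spannedZ; apply: spanned_cons.
  move=> z; rewrite in_cons => /predU1P[->|/mapP[w wn ->]] /=.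
    by split=> //; exact: (spannedZ _ spsi).
  have [Sw sw] := nS w wn; split=> //; rewrite -scaleNr.
  exact: (spannedD (spanned_cons b sw) (spannedZ _ spsi)).
move=> p pb x Sx; rewrite big_cons big_map/= pevZ.
have [c cE] := dec p pb.
have -> : \sum_(z <- nodes) pev p z.1 * pev (z.2 - (pev z.2 y / pev psi y) *: psi) x =
    pev (I p) x - pev (I p) y / pev psi y * pev psi x.
  rewrite !IE !mulr_suml -sumrB; apply: eq_bigr => z _.
  by rewrite -scaleNr pevD pevZ; ring.
by rewrite (cE x Sx) (cE y Sy); field.
Qed.

Lemma poly_interpolation (S : set 'rV[R]_d) k :
  exists nodes : seq ('rV[R]_d * mpol),
    (forall z, z \in nodes -> S z.1 /\ (mpoly.msize z.2 <= k)%N) /\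
    forall p, (mpoly.msize p <= k)%N -> forall x, S x ->
      pev p x = \sum_(z <- nodes) pev p z.1 * pev z.2 x.
Proof.
pose s : seq mpol := [seq mpoly.mpolyX R (mpoly.bmnm m) | m : mpoly.bmultinom d k].
have [nodes [nS nI]] := spanned_interpolation S s.
exists nodes; split=> [z /nS[Sz sz]|p pk].
  split=> //; apply: spanned_msize sz => _ /mapP[m _ ->].
  by rewrite mpoly.msizeX; exact: mpoly.bmdeg.
apply: nI; rewrite (mpoly.mpolywE pk); apply: spanned_sum => m _.
by apply: spannedZ; apply: spanned_mem; apply: map_f; rewrite mem_enum.
Qed.

End interpolation.

(** * Bounded convergence, and C^1 fields by components *)

Section bounded_integration.
Context {disp : measure_display} {X : measurableType disp} {R : realType}.
Variables (mu : {measure set X -> \bar R}) (D : set X).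
Hypotheses (mD : measurable D) (muD : (mu D < +oo)%E).

Lemma integrable_bounded (f : X -> R) M : measurable_fun D f ->
  (forall x, D x -> `|f x| <= M) -> mu.-integrable D (EFin \o f).
Proof.
move=> mf fM; apply: measurable_bounded_integrable => //.
exists M; split; first exact: num_real.
by move=> M' MM' x Dx; apply: le_trans (ltW MM'); exact: fM.
Qed.

Lemma eq_Rintegral_ae (f g : X -> R) : measurable_fun D f -> measurable_fun D g ->
  {ae mu, forall x, D x -> f x = g x} ->
  \int[mu]_(x in D) f x = \int[mu]_(x in D) g x.
Proof.
move=> mf mg fg; congr fine; apply: ae_eq_integral => //; try exact/measurable_EFinP.
by apply: filterS fg => x /= h Dx; rewrite h.
Qed.

Lemma bounded_convergence (f_ : nat -> X -> R) (f : X -> R) M :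
  (forall n, measurable_fun D (f_ n)) -> measurable_fun D f ->
  {ae mu, forall x, D x -> f_ ^~ x @ \oo --> f x} ->
  {ae mu, forall x, D x -> forall n, `|f_ n x| <= M} ->
  \int[mu]_(x in D) f_ n x @[n --> \oo] --> \int[mu]_(x in D) f x.
Proof.
move=> mf_ mf f_f f_M.
have iM : mu.-integrable D (EFin \o (fun _ : X => M)).
  by apply: (@integrable_bounded _ `|M|) => //; exact: measurable_cst.
have [||||fi _ h] := @dominated_convergence _ _ _ mu D mD
  (fun n x => (f_ n x)%:E) (EFin \o f) (EFin \o (fun _ => M)) _ _ _ iM.
- by move=> n; exact/measurable_EFinP.
- exact/measurable_EFinP.
- apply: filterS f_f => x h Dx; apply: cvg_EFin; last exact: h.
  by apply: nearW.
- by apply: filterS f_M => x h n Dx; rewrite /= lee_fin; exact: h.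
apply: fine_cvg; rewrite fineK//.
exact: (integrable_fin_num mD fi).
Qed.

End bounded_integration.

Section field_of_components.
Context {R : realType} {d : nat}.
Variables (G : 'I_d -> 'rV[R]_d -> R) (dG : 'I_d -> 'rV[R]_d -> 'rV[R]_d -> R).
Hypothesis CG : forall j, C1 (G j) (dG j).

Let F x : 'rV[R]_d := \row_j G j x.

Let row_sum (a : 'I_d -> R) : \row_j a j = \sum_j a j *: delta_mx ord0 j :> 'rV[R]_d.
Proof.
apply/rowP => k; rewrite summxE (bigD1 k)//= big1 => [|j jk]; rewrite !mxE.
  by rewrite !eqxx mulr1 addr0.
by rewrite eqxx eq_sym (negbTE jk) mulr0.
Qed.

Lemma C1_field_row : C1_field F.
Proof.
have FE : F = \sum_j (fun x => G j x *: (delta_mx ord0 j : 'rV[R]_d)).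
  by apply/funext => x; rewrite /F row_sum fct_sumE.
have dF x : differentiable F x.
  rewrite FE; apply: differentiable_sum => j; apply: differentiableZl.
  by have [] := CG j.
split=> // v.
have -> : 'D_v F = fun x => \sum_j dG j v x *: (delta_mx ord0 j : 'rV[R]_d).
  apply/funext => x; rewrite -row_sum derive_mx; last exact: diff_derivable.
  apply/rowP => j; rewrite !mxE; have [_ <- _] := CG j.
  by congr ('D_v _ x); apply/funext => y; rewrite mxE.
move=> x; pose D j y := dG j v y *: (delta_mx ord0 j : 'rV[R]_d).
suff H r : \sum_(j <- r) D j y @[y --> x] --> \sum_(j <- r) D j x by exact: H.
elim: r => [|j r IH].
  by under eq_fun do rewrite big_nil; rewrite big_nil; exact: (@cst_continuous _ _ (0 : 'rV[R]_d) x).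
under eq_fun do rewrite big_cons; rewrite big_cons.
have [_ _ cdG] := CG j; have c := cdG v x.
exact: (cvgD (cvgZ c (@cst_continuous _ _ (delta_mx ord0 j : 'rV[R]_d) x)) IH).
Qed.

Lemma divergence_row x :
  divergence F x = \sum_j dG j (delta_mx ord0 j) x.
Proof.
apply: eq_bigr => j _; have [_ <- _] := CG j.
by congr ('D__ _ x); apply/funext => y; rewrite mxE.
Qed.

End field_of_components.

(** * Integration of piecewise polynomials *)

Section piecewise_integration.
Context {R : realType} {d : nat}.
Variables (Omega : set 'rV[R]_d) (T : @mesh R d).
Hypotheses (d_gt0 : (0 < d)%N) (T_mesh : conforming_mesh Omega T).
Notation K := 'I_(mesh_size T).
Notation mpol := (mpoly.mpoly d R).

(** Extended by zero, a polynomial on one element is a member of the broken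
    polynomial space, hence an admissible test function. *)
Definition piece (k : K) (q : mpol) (x : 'rV[R]_d) : R :=
  \1_(interior (element k)) x * pev q x.

Lemma piece_in (k : K) q x : interior (element k) x -> piece k q x = pev q x.
Proof. by move=> kx; rewrite /piece indicE mem_set// mul1r. Qed.

Lemma piece_out (k : K) q x : ~ interior (element k) x -> piece k q x = 0.
Proof. by move=> kx; rewrite /piece indicE memNset// mul0r. Qed.

Lemma piece_other (k l : K) q x : interior (element k) x -> l != k -> piece l q x = 0.
Proof.
move=> kx lk; apply: piece_out => lx; move: lk.
by rewrite (interior_element_other T_mesh kx (interior_subset lx)) eqxx.
Qed.

Definition piecewise (q : K -> mpol) x : R := \sum_k piece k (q k) x.

Lemma piecewise_in (k : K) q x : interior (element k) x ->
  piecewise q x = pev (q k) x.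
Proof.
move=> kx; rewrite /piecewise (bigD1 k)//= big1 ?addr0 => [|l]; first exact: piece_in.
exact: piece_other.
Qed.

Lemma measurable_interior_element (k : K) :
  measurable (interior (element k) : set (borelRn R d)).
Proof. by apply: open_measurable_Rn; exact: open_interior. Qed.

Lemma measurable_pev (q : mpol) D : measurable_fun (D : set (borelRn R d)) (pev q).
Proof.
apply: measurable_funTS; apply: continuous_measurable_Rn; exact: continuous_pev.
Qed.

Lemma measurable_piece (k : K) q D :
  measurable_fun (D : set (borelRn R d)) (piece k q).
Proof.
apply: measurable_funM; last exact: measurable_pev.
by apply: measurable_indic; exact: measurable_interior_element.
Qed.

Lemma measurable_piecewise q D :
  measurable_fun (D : set (borelRn R d)) (piecewise q).
Proof. by apply: measurable_sum => k; exact: measurable_piece. Qed.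

Lemma interior_element_finite (k : K) :
  (lebesgueRn d (interior (element k)) < +oo)%E.
Proof.
apply: bounded_lebesgue_finite; last exact: measurable_interior_element.
exists (\sum_i `|mesh_vertex k i|); split; first exact: num_real.
move=> M MM x kx; apply: le_trans (ltW MM).
exact: (simplex_norm_le (mesh_nondegenerate T_mesh k) (interior_subset kx)).
Qed.

Lemma piece_bounded (k : K) q : exists M, forall x, `|piece k q x| <= M.
Proof.
pose S := \sum_i `|mesh_vertex k i|.
have [L [L0 bd _]] := pev_bounded_lipschitz q S.
exists L => x; have [kx|kx] := pselect (interior (element k) x).
  rewrite piece_in//; apply: bd.
  exact: (simplex_norm_le (mesh_nondegenerate T_mesh k) (interior_subset kx)).
by rewrite piece_out// normr0.
Qed.

Lemma integrable_pev_element (k : K) q :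
  (lebesgueRn d).-integrable (interior (element k)) (EFin \o pev q).
Proof.
have [M pM] := piece_bounded k q.
apply: (integrable_bounded (measurable_interior_element k)
  (interior_element_finite k) (M := M)) => [|x kx]; first exact: measurable_pev.
by rewrite -(piece_in q kx).
Qed.

Lemma mesh_interiors_full : (lebesgueRn d).-negligible
  (closure Omega `\` \bigcup_(k : K) interior (element k)).
Proof.
have n : (lebesgueRn d).-negligible
    (\bigcup_(k : K) (element k `\` interior (element k))).
  apply: negligible_bigcup_fin => k.
  exact: (simplex_frontier_null d_gt0 (mesh_nondegenerate T_mesh k)).
apply: (negligibleS _ n) => x [].
rewrite (mesh_cover T_mesh) => -[k _ kx] nx; exists k => //; split=> // ikx.
by apply: nx; exists k.
Qed.

Variable V : set 'rV[R]_d.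
Hypotheses (mV : measurable (V : set (borelRn R d)))
  (muV : (lebesgueRn d V < +oo)%E) (VO : V `<=` Omega).

Lemma ae_in_interior (P : 'rV[R]_d -> Prop) :
  (forall (k : K) x, V x -> interior (element k) x -> P x) ->
  {ae lebesgueRn d, forall x, V x -> P x}.
Proof.
move=> h; apply: (negligibleS _ mesh_interiors_full) => x /= nP.
have [Vx nPx] : V x /\ ~ P x by exact/not_implyP.
split; first by apply: subset_closure; exact: VO.
by move=> [k _ kx]; apply: nPx; exact: h kx.
Qed.

Lemma integrable_piece (k : K) q :
  (lebesgueRn d).-integrable V (EFin \o piece k q).
Proof.
have [M pM] := piece_bounded k q.
by apply: (integrable_bounded mV muV (M := M)) => //; exact: measurable_piece.
Qed.

(** The integral over [V] of a piecewise polynomial is the sum of such numbers,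
    each of them linear in the polynomial on its element. *)
Definition pint (k : K) q : R := \int[lebesgueRn d]_(x in V) piece k q x.

Lemma pintD k p q : pint k (p + q) = pint k p + pint k q.
Proof.
rewrite /pint -RintegralD//; try exact: integrable_piece.
by apply: eq_Rintegral => x _; rewrite /piece pevD mulrDr.
Qed.

Lemma pintZ k c q : pint k (c *: q) = c * pint k q.
Proof.
rewrite /pint -RintegralZl//; last exact: integrable_piece.
by apply: eq_Rintegral => x _; rewrite /piece pevZ mulrCA.
Qed.

Lemma pint0 k : pint k 0 = 0.
Proof. by rewrite -(scale0r (0 : mpol)) pintZ mul0r. Qed.

Lemma pint_sum k (I : Type) (r : seq I) (f : I -> mpol) :
  pint k (\sum_(i <- r) f i) = \sum_(i <- r) pint k (f i).
Proof.
elim/big_rec2 : _ => [|i y1 y2 _ <-]; first exact: pint0.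
exact: pintD.
Qed.

Lemma piecewise_int q :
  \int[lebesgueRn d]_(x in V) piecewise q x = \sum_k pint k (q k).
Proof.
rewrite /piecewise; elim: (index_enum _) => [|k r IH].
  under eq_Rintegral do rewrite big_nil.
  by rewrite big_nil Rintegral_cst// mul0r.
under eq_Rintegral do rewrite big_cons.
rewrite big_cons RintegralD//; first by rewrite IH.
  exact: integrable_piece.
rewrite (_ : _ \o _ = fun x => \sum_(j <- r) (piece j (q j) x)%:E)%E.
  by apply: integrable_sum => // j _; exact: integrable_piece.
by apply/funext => x /=; rewrite sumEFin.
Qed.

Lemma Rintegral_piecewise (f : 'rV[R]_d -> R) q :
  measurable_fun (V : set (borelRn R d)) f ->
  (forall (k : K) x, V x -> interior (element k) x -> f x = pev (q k) x) ->
  \int[lebesgueRn d]_(x in V) f x = \sum_k pint k (q k).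
Proof.
move=> mf fq; rewrite -piecewise_int; apply: eq_Rintegral_ae => //.
  exact: measurable_piecewise.
by apply: ae_in_interior => k x Vx kx; rewrite (piecewise_in _ kx); exact: fq.
Qed.

(** A polynomial whose square has integral zero over the element vanishes almost
    everywhere there, and so its integral over the part of [V] in the element is
    zero. *)
Lemma pint_square_free (k : K) (r : mpol) :
  \int[lebesgueRn d]_(x in interior (element k)) pev (r * r) x = 0 ->
  pint k r = 0.
Proof.
move=> r0; pose D := interior (element k) : set (borelRn R d).
have mD : measurable D := measurable_interior_element k.
have mf : measurable_fun D (EFin \o pev (r * r)).
  by apply/measurable_EFinP; exact: measurable_pev.
have abs0 : (\int[lebesgueRn d]_(x in D) `|(EFin \o pev (r * r)%R) x| = 0)%E.
  transitivity (\int[lebesgueRn d]_(x in D) (pev (r * r)%R x)%:E)%E.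
    apply: eq_integral => x _ /=.
    by rewrite ger0_norm// pevM -expr2 sqr_ge0.
  rewrite -(fineK (integrable_fin_num mD (integrable_pev_element k _))).
  by congr EFin; exact: r0.
have ae0 := (ae_eq_integral_abs (lebesgueRn d) mD mf).1 abs0.
rewrite /pint (@eq_Rintegral_ae _ _ _ (lebesgueRn d) V mV _ (fun=> 0)).
- by rewrite Rintegral_cst// mul0r.
- exact: measurable_piece.
- exact: measurable_cst.
- apply: filterS ae0 => x /= h Vx.
  have [Dx|nDx] := pselect (D x); last exact: piece_out.
  rewrite piece_in//; have [] := h Dx => /eqP.
  by rewrite pevM mulf_eq0 orbb => /eqP.
Qed.

End piecewise_integration.

(** * The divergence theorem for continuous piecewise polynomials *)

Section flux.
Context {R : realType} {d : nat}.
Variables (Omega : set 'rV[R]_d) (T : @mesh R d).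
Hypotheses (d_gt0 : (0 < d)%N) (T_mesh : conforming_mesh Omega T).
Notation K := 'I_(mesh_size T).
Variables (V : set 'rV[R]_d) (nu : 'rV[R]_d -> 'rV[R]_d).
Hypotheses (Vnu : volume V nu) (VO : V `<=` Omega).

Notation surf := (@surface_type R d).

Lemma volume_lebesgue_finite : (lebesgueRn d V < +oo)%E.
Proof. exact: bounded_lebesgue_finite (volume_bounded Vnu) (volume_measurable Vnu). Qed.

Lemma measurable_boundary (A : set 'rV[R]_d) : measurable (boundary A : set surf).
Proof.
apply: hausdorff_borel; apply: closed_measurable_Rn; rewrite /boundary setDE.
apply: closedI; first exact: closed_closure.
exact/open_closedC/open_interior.
Qed.

Lemma continuous_measurable_surface (D : set 'rV[R]_d) (g : 'rV[R]_d -> R) :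
  continuous g -> measurable_fun (D : set surf) (g : surf -> R).
Proof.
move=> cg; apply: (measurable_funTS (D := D : set surf)) => _ B mB.
have := continuous_measurable_Rn cg measurableT mB.
by rewrite !setTI; exact: hausdorff_borel.
Qed.

Variables (g : 'I_d -> 'rV[R]_d -> R) (p : 'I_d -> K -> mpoly.mpoly d R).
Hypothesis gp : forall j (k : K) x, element k x -> g j x = pev (p j k) x.

(** The components of the flux are replaced by their smooth approximations, for
    which the divergence theorem is available.  In the interior integral the
    divergences are uniformly bounded and converge off the faces of the mesh;
    in the boundary integral the normal is a unit vector almost everywhere and
    the approximations converge at every point. *)
Lemma boundary_flux :
  \int[surface_measure]_(x in boundary V) dotv (\row_j g j x) (nu x) =
  \sum_k pint V k (\sum_j mpoly.mderiv j (p j k)).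
Proof.
have [G /choice[dG GP]] := choice (fun j => lagrange_smoothing d_gt0 T_mesh (gp j)).
have CG n j : C1 (G j n) (dG j n) by have [h _ _ _ _] := GP j; exact: h.
pose F n x : 'rV[R]_d := \row_j G j n x.
have divF n := volume_divergence_theorem Vnu (C1_field_row (CG n)).
have mV := volume_measurable Vnu.
have VcO x : V x -> closure Omega x by move=> /VO; exact: subset_closure.
pose q k := \sum_j mpoly.mderiv j (p j k).
have lim1 : \int[lebesgueRn d]_(x in V) divergence (F n) x @[n --> \oo] -->
    \sum_k pint V k (q k).
  rewrite -(piecewise_int T_mesh mV volume_lebesgue_finite).
  have /choice[B BP] j : exists M, forall n x, closure Omega x ->
      `|dG j n (delta_mx ord0 j) x| <= M by have [_ _ _ h _] := GP j; exact: h.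
  apply: (@bounded_convergence _ (borelRn R d) _ _ V mV volume_lebesgue_finite _ _
    (\sum_j B j)).
  - move=> n; rewrite (_ : divergence (F n) = fun x => \sum_j dG j n (delta_mx ord0 j) x).
      apply: measurable_sum => j; apply: measurable_funTS; apply: continuous_measurable_Rn.
      by have [] := CG n j.
    by apply/funext => x; exact: (divergence_row (CG n)).
  - exact: measurable_piecewise.
  - apply: (ae_in_interior d_gt0 T_mesh VO) => k x Vx kx.
    rewrite (piecewise_in T_mesh _ kx) pev_sum.
    under eq_fun do rewrite (divergence_row (CG _)).
    apply: cvg_sumr => j _; have [_ _ _ _ /(_ k x (delta_mx ord0 j) kx)] := GP j.
    rewrite (bigD1 j)//= mxE !eqxx mul1r big1 ?addr0// => l lj.
    by rewrite mxE eqxx (negbTE lj) mul0r.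
  - apply: aeW => x Vx n; rewrite (divergence_row (CG n)).
    apply: (le_trans (ler_norm_sum _ _ _)); apply: ler_sum => j _.
    by apply: BP; exact: VcO.
have bcO x : boundary V x -> closure Omega x.
  by move=> [+ _]; exact: closureS.
have muD : (surface_measure (boundary V : set surf) < +oo)%E := volume_perimeter Vnu.
have lim2 : \int[surface_measure]_(x in boundary V) dotv (F n x) (nu x) @[n --> \oo] -->
    \int[surface_measure]_(x in boundary V) dotv (\row_j g j x) (nu x).
  have /choice[B BP] j : exists M, forall n x, closure Omega x -> `|G j n x| <= M.
    by have [_ _ h _ _] := GP j; exact: h.
  have mf n : measurable_fun (boundary V : set surf) (fun x => dotv (F n x) (nu x)).
    apply: measurable_sum => j; apply: measurable_funM.
      rewrite (_ : (fun x => _) = G j n); last by apply/funext => x; rewrite mxE.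
      by apply: continuous_measurable_surface; exact: (C1_continuous (CG n j)).
    exact: volume_measurable_normal.
  have cv x : boundary V x ->
      dotv (F n x) (nu x) @[n --> \oo] --> dotv (\row_j g j x) (nu x).
    move=> bx; apply: cvg_sumr => j _; rewrite mxE.
    under eq_fun do rewrite mxE.
    apply: cvgM; last exact: cvg_cst.
    by have [_ h _ _ _] := GP j; apply: h; exact: bcO.
  have mlim : measurable_fun (boundary V : set surf)
      (fun x => dotv (\row_j g j x) (nu x)) by exact: measurable_fun_cvg mf cv.
  have acv : {ae @surface_measure R d, forall x, boundary V x ->
      dotv (F n x) (nu x) @[n --> \oo] --> dotv (\row_j g j x) (nu x)}.
    exact: aeW.
  have h := (@bounded_convergence _ surf _ surface_measure (boundary V)
    (measurable_boundary V) muD (fun n x => dotv (F n x) (nu x))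
    (fun x => dotv (\row_j g j x) (nu x)) (\sum_j B j) mf mlim acv).
  apply: h.
  apply: (negligibleS _ (volume_normal Vnu)) => x /= nP nx; apply: nP => bx n.
  have [nu1 _ _] := nx bx.
  apply: (le_trans (ler_norm_sum _ _ _)); apply: ler_sum => j _.
  rewrite normrM mxE -[X in _ <= X]mulr1; apply: ler_pM => //.
    by apply: BP; exact: bcO.
  by rewrite -nu1 coord_le_enorm.
have E : (fun n => \int[lebesgueRn d]_(x in V) divergence (F n) x) =
    (fun n => \int[surface_measure]_(x in boundary V) dotv (F n x) (nu x)).
  by apply/funext => n; exact: divF.
by rewrite E in lim1; exact: (cvg_unique _ lim2 lim1).
Qed.

End flux.

Section time.
Context {R : realType}.

Lemma is_derive_lincomb (I : eqType) (r : seq I) (a : I -> R -> R) (c : I -> R) (t : R) :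
  (forall z, z \in r -> derivable (a z) t 1) ->
  is_derive t 1 (fun s => \sum_(z <- r) a z s * c z)
    (\sum_(z <- r) derive1 (a z) t * c z).
Proof.
elim: r => [|z r IH] da.
  under eq_fun do rewrite big_nil; rewrite big_nil; exact: is_derive_cst.
under eq_fun do rewrite big_cons; rewrite big_cons.
have h1 : is_derive t 1 (a z) (derive1 (a z) t).
  by rewrite derive1E; apply: derivableP; apply: da; rewrite mem_head.
have h2 : is_derive t 1 (fun s => a z s * c z) (derive1 (a z) t * c z).
  have h := is_deriveM h1 (is_derive_cst (c z) t 1).
  rewrite scaler0 add0r in h.
  rewrite mulrC; exact: h.
apply: is_deriveD => //; apply: IH => w wr.
by apply: da; rewrite in_cons wr orbT.
Qed.

End time.

(** * The conservation relation *)

Section conservation.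
Context {R : realType} {d : nat}.
Notation mpol := (mpoly.mpoly d R).

Lemma divergence_on_open (F : 'rV[R]_d -> 'rV[R]_d) (p : 'I_d -> mpol) (U : set 'rV[R]_d) x :
  open U -> U x -> (forall y, U y -> forall j, F y ord0 j = pev (p j) y) ->
  divergence F x = pev (\sum_j mpoly.mderiv j (p j)) x.
Proof.
move=> oU Ux Fp; rewrite pev_sum; apply: eq_bigr => j _.
have -> : 'D_(delta_mx ord0 j) (fun y => F y ord0 j) x = 'D_(delta_mx ord0 j) (pev (p j)) x.
  apply: near_eq_derive.
  by apply: filterS (open_nbhs_nbhs (conj oU Ux)) => y Uy; exact: Fp.
have [_ -> _] := C1_pev (p j).
rewrite (bigD1 j)//= mxE !eqxx mul1r big1 ?addr0// => i ij.
by rewrite mxE eqxx (negbTE ij) mul0r.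
Qed.

(** The nodes and basis polynomials do not depend on the time [s], so that the
    time derivative is again a combination of the same basis polynomials. *)
Lemma time_derivative_nodes (J : set R) (t : R) (S : set 'rV[R]_d) k
    (w : R -> 'rV[R]_d -> R) :
  open J -> J t ->
  (forall s, J s -> polynomial_on k S (w s)) ->
  (forall x, S x -> derivable (w ^~ x) t 1) ->
  exists nodes : seq ('rV[R]_d * mpol), [/\
    forall z, z \in nodes -> S z.1 /\ (mpoly.msize z.2 <= k.+1)%N,
    forall s, J s -> forall x, S x -> w s x = \sum_(z <- nodes) w s z.1 * pev z.2 x &
    forall x, S x -> derive1 (w ^~ x) t =
       \sum_(z <- nodes) derive1 (w ^~ z.1) t * pev z.2 x].
Proof.
move=> oJ Jt wp dw; have [nodes [nS nI]] := poly_interpolation S k.+1.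
have wE s : J s -> forall x, S x -> w s x = \sum_(z <- nodes) w s z.1 * pev z.2 x.
  move=> Js x Sx; have [p pk wE] := wp s Js; rewrite wE// -/(pev p x) (nI p pk x Sx).
  rewrite big_seq [in RHS]big_seq; apply: eq_bigr => z zn.
  by rewrite wE//; exact: (nS z zn).1.
exists nodes; split=> // x Sx.
have h := @is_derive_lincomb R _ nodes (fun z s => w s z.1) (fun z => pev z.2 x) t
  (fun z zn => dw _ (nS z zn).1).
rewrite derive1E; apply: derive_val; apply: near_eq_is_derive h.
by apply: filterS (open_nbhs_nbhs (conj oJ Jt)) => s Js; rewrite -wE.
Qed.

End conservation.

Theorem proposition3 (R : realType) (d m N : nat) (d_gt0 : (0 < d)%N)
    (Omega : set 'rV[R]_d) (Omega_domain : domain Omega)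
    (T : @mesh R d) (T_mesh : conforming_mesh Omega T)
    (D : set 'rV[R]_m) (f : 'rV[R]_m -> 'M[R]_(m, d))
    (f_hyperbolic : hyperbolic D f)
    (P : ('rV[R]_d -> 'rV[R]_m) -> 'rV[R]_d -> 'rV[R]_m)
    (P_projector : projector Omega T N P)
    (J : set R) (J_open : open J) (J_interval : is_interval J)
    (u : R -> 'rV[R]_d -> 'rV[R]_m)
    (ftilde : R -> 'rV[R]_d -> 'M[R]_(m, d))
    (ftilde_interpolant : forall t, J t ->
       nodal_interpolant Omega T N.+1 (fun x => f (P (u t) x)) (ftilde t))
    (u_solution : semidiscrete_solution Omega T N J u ftilde)
    (V : set 'rV[R]_d) (n : 'rV[R]_d -> 'rV[R]_d)
    (V_volume : volume V n) (V_Omega : V `<=` Omega)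
    (t : R) (t_J : J t) (i : 'I_m) :
  let mass s := \int[lebesgueRn d]_(x in V) u s x ord0 i in
  derivable mass t 1 /\
  derive1 mass t +
    \int[surface_measure]_(x in boundary V) dotv (row i (ftilde t x)) (n x) = 0.
Proof.
move=> mass; have [u_dg u_deriv u_eq] := u_solution.
have mV := volume_measurable V_volume.
have muV := volume_lebesgue_finite V_volume.
have /choice[p pP] j : exists p : 'I_(mesh_size T) -> mpoly.mpoly d R, forall k,
    (mpoly.msize (p k) <= N.+2)%N /\
    forall x, element k x -> ftilde t x i j = pev (p k) x.
  have [fW _] := ftilde_interpolant t t_J; have [_ h] := fW i j.
  have /choice[p pP] (k : 'I_(mesh_size T)) : exists q : mpoly.mpoly d R,
      (mpoly.msize q <= N.+2)%N /\ forall x, element k x -> ftilde t x i j = pev q x.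
    by have [q q1 q2] := h k; exists q.
  by exists p.
pose divp (k : 'I_(mesh_size T)) := \sum_j mpoly.mderiv j (p j k).
have /choice[nodes nP] := fun k : 'I_(mesh_size T) => time_derivative_nodes J_open t_J
  (fun s Js => (u_dg s Js ord0 i).2 k) (fun x kx => u_deriv t t_J k x kx i).
pose du z := derive1 (fun s => u s z ord0 i) t.
pose dtu (k : 'I_(mesh_size T)) := \sum_(z <- nodes k) du z.1 *: z.2.
have duE (k : 'I_(mesh_size T)) x : interior (element k) x ->
    derive1 (fun s => u s x ord0 i) t = pev (dtu k) x.
  move=> kx; have [_ _ ->//] := nP k; rewrite /dtu pev_sum.
  by apply: eq_bigr => z _; rewrite pevZ.
have divE (k : 'I_(mesh_size T)) x : interior (element k) x ->
    divergence (fun y => row i (ftilde t y)) x = pev (divp k) x.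
  move=> kx; apply: (divergence_on_open (@open_interior _ _) kx) => y ky j.
  by rewrite mxE; apply: (pP j k).2; exact: interior_subset.
(* The scheme is tested with the residual itself, restricted to one element. *)
have residual0 (k : 'I_(mesh_size T)) : pint V k (dtu k + divp k) = 0.
  apply: (pint_square_free T_mesh mV).
  pose r := dtu k + divp k.
  have rN : (mpoly.msize r <= N.+1)%N.
    apply: (leq_trans (mpoly.msizeD_le _ _)); rewrite geq_max; apply/andP; split.
      apply: (leq_trans (mpoly.msize_sum _ _ _)); apply/bigmax_leqP_seq => z zn _.
      by apply: (leq_trans (mpoly.msizeZ_le _ _)); have [h _ _] := nP k; exact: (h z zn).2.
    apply: (leq_trans (mpoly.msize_sum _ _ _)); apply/bigmax_leqP_seq => j _ _.
    by apply: msize_mderiv_le; exact: (pP j k).1.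
  have phi_dg : dg_space Omega T N (piece k r).
    split; first exact: measurable_piece.
    move=> l; have [->|kl] := eqVneq l k.
      by exists r => // x kx; exact: piece_in.
    exists 0; first by rewrite mpoly.msize0.
    move=> x lx; rewrite (piece_other T_mesh r lx); last by rewrite eq_sym.
    exact/esym/pev0.
  have := u_eq t t_J k i _ phi_dg.
  pose E := interior (element k).
  have -> : \int[lebesgueRn d]_(x in E) (piece k r x * derive1 (fun s => u s x ord0 i) t) =
      \int[lebesgueRn d]_(x in E) pev (r * dtu k) x.
    by apply: eq_Rintegral => x /set_mem kx; rewrite piece_in// (duE _ _ kx) pevM.
  have -> : \int[lebesgueRn d]_(x in E)
        (piece k r x * divergence (fun y => row i (ftilde t y)) x) =
      \int[lebesgueRn d]_(x in E) pev (r * divp k) x.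
    by apply: eq_Rintegral => x /set_mem kx; rewrite piece_in// (divE _ _ kx) pevM.
  have integ q := integrable_pev_element T_mesh k q.
  rewrite -RintegralD//; last exact: measurable_interior_element.
  by move=> <-; apply: eq_Rintegral => x _; rewrite -pevD -mulrDr.
(* Near [t] the mass is a combination of point values with constant weights. *)
have massE s : J s -> mass s =
    \sum_k \sum_(z <- nodes k) u s z.1 ord0 i * pint V k z.2.
  move=> Js; rewrite /mass.
  rewrite (@Rintegral_piecewise _ _ Omega T d_gt0 T_mesh V mV muV V_Omega _
     (fun k => \sum_(z <- nodes k) u s z.1 ord0 i *: z.2)).
  - apply: eq_bigr => k _; rewrite (pint_sum T_mesh mV muV); apply: eq_bigr => z _.
    exact: (pintZ T_mesh mV muV).
  - have [mu_ _] := u_dg s Js ord0 i.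
    have mOmega : measurable (Omega : set (borelRn R d)).
      by apply: open_measurable_Rn; have [] := Omega_domain.
    exact: (measurable_funS mOmega V_Omega mu_).
  - move=> k x Vx kx; have [_ -> // _] := nP k.
    by rewrite pev_sum; apply: eq_bigr => z _; rewrite pevZ.
have mass_derive : is_derive t 1 mass (\sum_k pint V k (dtu k)).
  have h : is_derive t (1 : R)
      (fun s => \sum_k \sum_(z <- nodes k) u s z.1 ord0 i * pint V k z.2)
      (\sum_k \sum_(z <- nodes k) du z.1 * pint V k z.2).
    have Hk (k : 'I_(mesh_size T)) : is_derive t (1 : R)
      (fun s => \sum_(z <- nodes k) u s z.1 ord0 i * pint V k z.2)
      (\sum_(z <- nodes k) du z.1 * pint V k z.2).
      apply: (is_derive_lincomb (a := fun z s => u s z.1 ord0 i)) => z zn.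
      by have [h _ _] := nP k; apply: u_deriv t_J k _ (h z zn).1 i.
    by have := is_derive_sum Hk; rewrite fct_sumE.
  apply: is_derive_eq.
    apply: near_eq_is_derive h.
    by apply: filterS (open_nbhs_nbhs (conj J_open t_J)) => s Js; rewrite massE.
  apply: eq_bigr => k _; rewrite (pint_sum T_mesh mV muV); apply: eq_bigr => z _.
  by rewrite (pintZ T_mesh mV muV).
split; first exact: ex_derive.
rewrite derive1E derive_val.
have -> : \int[surface_measure]_(x in boundary V) dotv (row i (ftilde t x)) (n x) =
    \sum_k pint V k (divp k).
  rewrite -(boundary_flux d_gt0 T_mesh V_volume V_Omega
    (g := fun j x => ftilde t x i j) (fun j k => (pP j k).2)).
  have rowE x : row i (ftilde t x) = \row_j ftilde t x i j.
    by apply/rowP => j; rewrite !mxE.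
  by apply: eq_Rintegral => x _; rewrite rowE.
rewrite -big_split/=; apply: big1 => k _.
by rewrite -(pintD T_mesh mV muV).
Qed.
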